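(* Fix constants $P_1,\dots,P_N\ge0$. For each $M$ let $\mathbf{a}^{(M)}\in\mathbb{C}^N$ satisfy $|a_i^{(M)}|^2=P_i/\sqrt{M}$. Then, almost surely, $$\lim_{M\to\infty}D_{\mathbf{H}_M}(\mathbf{a}^{(M)})=\frac{\sigma_\theta^4\Big(\sum_{i=1}^N P_i/d_i^{\alpha}\Big)^2}{\sum_{i=1}^N\sigma_{v,i}^4P_i^2/d_i^{2\alpha}+\sigma_n^4},$$ which does not depend on $M$; i.e. scaling the sensor transmit powers by $1/\sqrt{M}$ keeps the deflection of the energy detector asymptotically constant.
   Context: Constants: $\sigma_\theta^2,\sigma_n^2>0$, $\sigma_{v,i}^2>0$, $d_i>0$, $\alpha>0$; $\mathbf{V}=\mathrm{diag}\{\sigma_{v,1}^2,\dots,\sigma_{v,N}^2\}$. Channel: $(\tilde h_{mi})_{m\ge1,1\le i\le N}$ i.i.d. $\mathcal{CN}(0,1)$, $\mathbf{H}_M\in\mathbb{C}^{M\times N}$ with $[\mathbf{H}_M]_{mi}=\tilde h_{mi}/\sqrt{d_i^\alpha}$. For $\mathbf{a}\in\mathbb{C}^N$, $\mathbf{D}=\mathrm{diag}\{a_i\}$; with $\theta\sim\mathcal{CN}(0,\sigma_\theta^2)$, $\mathbf{v}\sim\mathcal{CN}(\mathbf{0},\mathbf{V})$, $\mathbf{n}\sim\mathcal{CN}(\mathbf{0},\sigma_n^2\mathbf{I}_M)$ independent, $\mathcal{H}_0:\mathbf{y}=\mathbf{H}\mathbf{D}\mathbf{v}+\mathbf{n}$,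 $\mathcal{H}_1:\mathbf{y}=\mathbf{H}\mathbf{a}\theta+\mathbf{H}\mathbf{D}\mathbf{v}+\mathbf{n}$. Energy detector statistic $T=\frac1M\mathbf{y}^H\mathbf{y}$. Deflection (with $\mathbf{H}$ held fixed, expectations over $\theta,\mathbf{v},\mathbf{n}$): $D_{\mathbf{H}}(\mathbf{a})=\dfrac{(\mathbb{E}\{T|\mathcal{H}_1\}-\mathbb{E}\{T|\mathcal{H}_0\})^2}{\mathrm{Var}\{T|\mathcal{H}_0\}}$. *)

(* Defs.v *)
From HB Require Import structures.
From mathcomp Require Import all_boot all_order all_algebra.
From mathcomp Require Import all_classical all_reals all_analysis.
From mathcomp Require Import complex.

Set Implicit Arguments.
Unset Strict Implicit.
Unset Printing Implicit Defensive.

Import Order.TTheory GRing.Theory Num.Theory.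
Import numFieldNormedType.Exports.
Local Open Scope classical_set_scope.
Local Open Scope ring_scope.
Local Open Scope complex_scope.

Definition cabs2 {R : realType} (z : R[i]) : R :=
  complex.Re z ^+ 2 + complex.Im z ^+ 2.

Definition mutually_independent {d} {T : measurableType d} {R : realType}
    (P : probability T R) {I : eqType} (X : I -> {RV P >-> R}) : Prop :=
  forall (J : seq I) (B : I -> set R), uniq J -> (forall j, measurable (B j)) ->
    P (\bigcap_(j in [set` J]) (X j @^-1` B j)) =
    (\prod_(j <- J) P (X j @^-1` B j))%E.

(** X ~ CN(0, s2) : real and imaginary parts (indexed by true/false) are
    independent N(0, s2/2); independence is imposed globally via
    [mutually_independent].  Here we state the marginal law of one real part. *)
Definition has_normal_law {d} {T : measurableType d} {R : realType}
    (P : probability T R) (X : {RV P >-> R}) (var : R) : Prop :=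
  distribution P X = normal_prob 0 (Num.sqrt var).

Definition cRV {d} {T : measurableType d} {R : realType} (P : probability T R)
    (X : bool -> {RV P >-> R}) (w : T) : R[i] := X true w +i* X false w.

Definition noise_family {d} {T : measurableType d} {R : realType}
    (Q : probability T R) (N : nat)
    (th : bool -> {RV Q >-> R}) (v : 'I_N -> bool -> {RV Q >-> R})
    (n : nat -> bool -> {RV Q >-> R}) :
    option ('I_N + nat) * bool -> {RV Q >-> R} :=
  fun k => match k.1 with
           | None => th k.2
           | Some (inl i) => v i k.2
           | Some (inr m) => n m k.2
           end.

Definition energy_stat {d} {T : measurableType d} {R : realType}
    (Q : probability T R) (N : nat)
    (th : bool -> {RV Q >-> R}) (v : 'I_N -> bool -> {RV Q >-> R})
    (n : nat -> bool -> {RV Q >-> R})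
    (H : nat -> 'I_N -> R[i]) (M : nat) (a : 'I_N -> R[i]) (hyp1 : bool)
    (w : T) : R :=
  (M%:R)^-1 * \sum_(m < M)
     cabs2 ((if hyp1 then (\sum_(i < N) H m i * a i) * cRV th w else 0)
            + \sum_(i < N) H m i * (a i * cRV (v i) w)
            + cRV (n m) w).

Definition deflection {d} {T : measurableType d} {R : realType}
    (Q : probability T R) (N : nat)
    (th : bool -> {RV Q >-> R}) (v : 'I_N -> bool -> {RV Q >-> R})
    (n : nat -> bool -> {RV Q >-> R})
    (H : nat -> 'I_N -> R[i]) (M : nat) (a : 'I_N -> R[i]) : R :=
  let T0 := energy_stat th v n H M a false in
  let T1 := energy_stat th v n H M a true in
  (fine 'E_Q[T1] - fine 'E_Q[T0]) ^+ 2 / fine ('V_Q[T0]).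

Definition channel {d} {T : measurableType d} {R : realType}
    (P : probability T R) (N : nat)
    (h : nat -> 'I_N -> bool -> {RV P >-> R}) (dist : 'I_N -> R) (alpha : R)
    (w : T) : nat -> 'I_N -> R[i] :=
  fun m i => cRV (h m i) w * ((Num.sqrt (dist i `^ alpha))^-1)%:C.

(* Main.v *)
Require Import Defs.
From HB Require Import structures.
From mathcomp Require Import all_boot all_order all_algebra.
From mathcomp Require Import all_classical all_reals all_analysis.
From mathcomp Require Import complex measurable_realfun.
From mathcomp Require Import zify ring lra.
Import Order.TTheory GRing.Theory Num.Theory.
Import numFieldNormedType.Exports.
Local Open Scope classical_set_scope.
Local Open Scope ring_scope.

(**
  Stacking real and imaginary parts, [M T] is a sum of squares of linear forms
  in independent centred real Gaussians.  Wick's formula for four factors gives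
  [Var (sum_r L_r^2) = 2 sum_(r, s) Cov (L_r, L_s)^2], so that, for a fixed
  channel, the deflection is an explicit rational function of the entries of
  the Gram matrix of the columns of [H D].  Under the power scaling
  [|a_i|^2 = P_i / sqrt M], these entries divided by [sqrt M] converge almost
  surely to [P_i / d_i^alpha] on the diagonal and to [0] off it: this is the
  strong law of large numbers for the products of two channel coefficients,
  which are uncorrelated in [m] with bounded variance.  Numerator and
  denominator of the deflection are then both of order [1 / M].
*)

Import HBNNSimple.

(** Independence is given only as a product rule for events, while Wick's formula concerns products
    of signed powers; the gap is bridged through indicators, nonnegative functions and the splitting
    into positive and negative parts. Only the moduli of the [a M i] are prescribed, so their phases
    may vary freely with [M] and the rescaled amplitudes need not converge. Each Gram entry is
    therefore split into channel averages, which converge, and coefficients built from [a], which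
    are merely bounded; against the limiting averages the phases cancel exactly. As a result the
    exceptional null set depends on the channel alone. Before division by [M ^ 2], the sensor-noise
    and receiver-noise parts of the variance are both of order [M], whereas their mixed term is only
    of order [sqrt M]; this is why the limit contains no cross term. *)

Lemma cvgn_inv_natr {R : realType} : (n%:R : R)^-1 @[n --> \oo] --> (0 : R).
Proof. by rewrite -cvg_shiftS; exact: cvg_harmonic. Qed.

(** * Integrable functions with a given mean *)

(** Integrability and a real value travel together, so that sums and scalings carry no side
    condition and second and fourth moments can be assembled as plain real expressions. *)
Definition has_mean {d} {T : measurableType d} {R : realType}
    (mu : {measure set T -> \bar R}) (f : T -> R) (v : R) : Prop :=
  mu.-integrable setT (EFin \o f) /\ (\int[mu]_x (f x)%:E = v%:E)%E.

Section has_mean_theory.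
Context {d} {T : measurableType d} {R : realType}.
Variable mu : {measure set T -> \bar R}.
Implicit Types (f g : T -> R) (v c : R).

Lemma has_mean_measurable f v : has_mean mu f v -> measurable_fun setT f.
Proof. by case=> /integrableP[/measurable_EFinP]. Qed.

Lemma has_mean_ext f g v : f =1 g -> has_mean mu f v -> has_mean mu g v.
Proof. by move=> /funext ->. Qed.

Lemma has_mean_ge0 f v : measurable_fun setT f -> (forall x, 0 <= f x) ->
  (\int[mu]_x (f x)%:E = v%:E)%E -> has_mean mu f v.
Proof.
move=> mf f0 fv; split => //; apply/integrableP; split; first exact/measurable_EFinP.
by under eq_integral do rewrite /= ger0_norm//; rewrite fv ltry.
Qed.

Lemma integrable_has_mean f : mu.-integrable setT (EFin \o f) ->
  has_mean mu f (fine (\int[mu]_x (f x)%:E)%E).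
Proof. by move=> fi; split => //; rewrite fineK// integrable_fin_num. Qed.

Lemma has_mean_unique f v w : has_mean mu f v -> has_mean mu f w -> v = w.
Proof. by move=> [_ fv] [_]; rewrite fv => -[]. Qed.

Lemma has_meanD f g v w : has_mean mu f v -> has_mean mu g w ->
  has_mean mu (fun x => f x + g x) (v + w).
Proof.
move=> [fi fv] [gi gw]; split; first exact: (integrableD measurableT fi gi).
by rewrite (integralD_EFin measurableT fi gi) fv gw.
Qed.

Lemma has_meanZ f v c : has_mean mu f v -> has_mean mu (fun x => c * f x) (c * v).
Proof.
move=> [fi fv]; split; first exact: (integrableZl measurableT c fi).
by under eq_integral do rewrite EFinM; rewrite integralZl// fv.
Qed.

Lemma has_meanB f g v w : has_mean mu f v -> has_mean mu g w ->
  has_mean mu (fun x => f x - g x) (v - w).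
Proof.
move=> fv /(has_meanZ _ _ (-1)) /(has_meanD _ _ _ _ fv).
by rewrite mulN1r; apply: has_mean_ext => x; rewrite mulN1r.
Qed.

Lemma has_mean0 : has_mean mu (fun=> 0) 0.
Proof. by split; [exact: integrable0|rewrite integral0]. Qed.

Lemma has_mean_sum (I : Type) (r : seq I) (F : I -> T -> R) (v : I -> R) :
  (forall i, has_mean mu (F i) (v i)) ->
  has_mean mu (fun x => \sum_(i <- r) F i x) (\sum_(i <- r) v i).
Proof.
move=> Fv; elim: r => [|i r ih].
  by rewrite big_nil; apply: has_mean_ext has_mean0 => x; rewrite big_nil.
rewrite big_cons; apply: has_mean_ext (has_meanD _ _ _ _ (Fv i) ih) => x.
by rewrite big_cons.
Qed.

End has_mean_theory.

Lemma has_mean_cst {d} {T : measurableType d} {R : realType}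
  (P : probability T R) (c : R) : has_mean P (fun=> c) c.
Proof.
split; first exact: finite_measure_integrable_cst.
by rewrite (integral_cst P measurableT c%:E)// [X in (_ * X)%E]probability_setT mule1.
Qed.

(* [G] acts as a density; the case [phi = id] is the usual density formula, the
   case of a constant density [c] expresses that [G] is independent of [phi]. *)
Lemma ge0_integral_density {d d'} {T : measurableType d} {Y : measurableType d'}
    {R : realType} (mu : {measure set T -> \bar R}) (nu : {measure set Y -> \bar R})
    (G : T -> R) (phi : T -> Y) (f : Y -> R) (c : R) :
  measurable_fun setT G -> measurable_fun setT phi -> measurable_fun setT f ->
  (forall x, 0 <= G x) -> (forall y, 0 <= f y) -> 0 <= c ->
  (forall B, measurable B ->
    \int[mu]_x (G x * \1_B (phi x))%:E = c%:E * nu B)%E ->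
  (\int[mu]_x (G x * f (phi x))%:E = c%:E * \int[nu]_y (f y)%:E)%E.
Proof.
move=> mG mphi mf G0 f0 c0 GB.
have mf' : measurable_fun setT (EFin \o f) by exact/measurable_EFinP.
pose h := nnsfun_approx measurableT mf'.
have hf y : (h n y)%:E @[n --> \oo] --> (f y)%:E.
  by apply: (@cvg_nnsfun_approx _ _ _ _ measurableT (EFin \o f) mf') => // z _; rewrite lee_fin.
have hnd y : {homo (fun n => h n y) : a b / (a <= b)%N >-> a <= b}.
  by move=> a b ab; exact/lefP/nd_nnsfun_approx.
have -> : (\int[nu]_y (f y)%:E = limn (fun n => \int[nu]_y (h n y)%:E))%E.
  rewrite -monotone_convergence//.
  - by apply: eq_integral => y _; apply/esym/cvg_lim => //; exact: hf.
  - by move=> n; exact/measurable_EFinP.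
  - by move=> n y _; rewrite lee_fin.
  - by move=> y _ a b ab; rewrite lee_fin hnd.
have mGh n : measurable_fun setT (fun x => (G x * h n (phi x))%:E).
  by apply/measurable_EFinP/measurable_funM => //; exact: measurableT_comp.
have -> : (\int[mu]_x (G x * f (phi x))%:E =
    limn (fun n => \int[mu]_x (G x * h n (phi x))%:E))%E.
  rewrite -monotone_convergence//.
  - apply: eq_integral => y _; apply/esym/cvg_lim => //.
    under eq_fun do rewrite EFinM; rewrite EFinM.
    by apply: cvgeZl => //; exact: hf.
  - by move=> n y _; rewrite lee_fin mulr_ge0.
  - by move=> y _ a b ab; rewrite lee_fin ler_wpM2l// hnd.
rewrite -limeMl//; last first.
  apply: ereal_nondecreasing_is_cvgn => a b ab; apply: ge0_le_integral => //.
  - by move=> y _; rewrite lee_fin.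
  - exact/measurable_EFinP.
  - exact/measurable_EFinP.
  - by move=> y _; rewrite lee_fin hnd.
(* Both sides are now limits along the same simple functions. For one simple function they are
   finite sums over its level sets, to each of which [GB] applies. *)
congr (limn _); apply/funext => n.
under [in RHS]eq_integral do rewrite fimfunE -fsumEFin//.
rewrite ge0_integral_fsum//; first last.
- by move=> r y _; exact: nnfun_muleindic_ge0.
- by move=> r; apply/measurable_EFinP/measurable_funM.
under [in LHS]eq_integral => x _.
  rewrite fimfunE EFinM -fsumEFin// ge0_mule_fsumr; last first.
    by move=> r; exact: nnfun_muleindic_ge0.
  over.
rewrite ge0_integral_fsum//; first last.
- by move=> r x _; rewrite mule_ge0 ?lee_fin//; exact: nnfun_muleindic_ge0.
- move=> r; apply: emeasurable_funM; first exact/measurable_EFinP.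
  by apply/measurable_EFinP/measurable_funM => //; exact: measurableT_comp.
rewrite ge0_mule_fsumr; last first.
  by move=> r; apply: integral_ge0 => y _; exact: nnfun_muleindic_ge0.
apply: eq_fsbigr => r; rewrite inE => -[y _ <-].
have mB : measurable (h n @^-1` [set h n y]) by [].
under [in RHS]eq_integral do rewrite EFinM.
rewrite [in RHS]ge0_integralZl//; first last.
- by rewrite lee_fin.
- by apply/measurable_EFinP; exact: measurable_indic.
rewrite integral_indic// setIT muleCA -GB//.
rewrite -ge0_integralZl//; first last.
- by rewrite lee_fin.
- by move=> x _; rewrite lee_fin mulr_ge0.
- by apply/measurable_EFinP/measurable_funM => //; apply: measurableT_comp.
by apply: eq_integral => x _; rewrite -!EFinM mulrCA.
Qed.

(** * Products of independent random variables *)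

Lemma has_mean_mean_ge0 {d} {T : measurableType d} {R : realType}
    (mu : {measure set T -> \bar R}) (f : T -> R) (v : R) :
  (forall x, 0 <= f x) -> has_mean mu f v -> 0 <= v.
Proof.
by move=> f0 [_ fv]; rewrite -lee_fin -fv integral_ge0// => x _; rewrite lee_fin.
Qed.

Section independent_products.
Context {d} {T : measurableType d} {R : realType} (P : probability T R).
Context {I : eqType} (X : I -> {RV P >-> R}).
Hypothesis indX : mutually_independent X.
Implicit Types (f : I -> R -> R) (v : I -> R) (s t : seq I).

Let has_mean_indic (i : I) (B : set R) : measurable B ->
  has_mean P (fun w => \1_B (X i w)) (fine (P (X i @^-1` B))).
Proof.
move=> mB; have mXB : measurable (X i @^-1` B) by exact: measurable_funPTI.
apply: has_mean_ge0 => //; first exact: measurableT_comp.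
rewrite -[X in X = _]/(\int[P]_w (\1_(X i @^-1` B) w)%:E)%E integral_indic// setIT.
by rewrite fineK// fin_num_measure.
Qed.

(* The factors indexed by [t] are indicators, as in the definition of
   independence; induction on [s] turns the other ones into arbitrary functions. *)
Let has_mean_prod_ge0_aux s t f v : uniq (s ++ t) ->
  (forall i, measurable_fun setT (f i)) -> (forall i x, 0 <= f i x) ->
  (forall i, has_mean P (fun w => f i (X i w)) (v i)) ->
  (forall j, j \in t -> exists2 B, measurable B & f j = \1_B) ->
  has_mean P (fun w => \prod_(i <- s ++ t) f i (X i w)) (\prod_(i <- s ++ t) v i).
Proof.
elim: s t f v => [|i s ih] t f v /=.
  move=> ut mf f0 fv ft.
  (* The sets provided by [ft] exist only for [j] in [t], but independence asks for a measurable set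
     at every index; the preimage of 1 is such a uniform choice and recovers the indicator on
     [t]. *)
  pose B j := f j @^-1` [set 1].
  have mB j : measurable (B j) by rewrite -[B j]setTI; exact: (mf j).
  have fB j : j \in t -> f j = \1_(B j).
    move=> /ft[C _ fC]; rewrite /B fC; congr indic; apply/seteqP; split => x /=.
      by rewrite indicE => /mem_set ->.
    by rewrite indicE; case: (boolP (x \in C)) => [/set_mem//|_ /esym/eqP]; rewrite oner_eq0.
  have vB j : j \in t -> P (X j @^-1` B j) = (v j)%:E.
    move=> jt; have [_ <-] := fv j; rewrite (fB _ jt).
    have [_ ->] := has_mean_indic j _ (mB j).
    by rewrite fineK// fin_num_measure//; exact: measurable_funPTI.
  apply: has_mean_ge0.
  - by apply: measurable_prod => i _; exact: measurableT_comp.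
  - by move=> w; exact: prodr_ge0.
  have -> : (\prod_(i <- t) v i)%:E = P (\bigcap_(j in [set` t]) (X j @^-1` B j)).
    rewrite (indX t B ut mB) [RHS]big_seq [in LHS]big_seq.
    rewrite (eq_bigr (fun j => (v j)%:E)); last by move=> j jt; rewrite vB.
    by elim/big_rec2 : _ => // j x y _ <-; rewrite EFinM.
  have mA : measurable (\bigcap_(j in [set` t]) (X j @^-1` B j)).
    apply: fin_bigcap_measurable; first exact: finite_seq.
    by move=> j _; exact: measurable_funPTI.
  rewrite -[X in P X]setIT -integral_indic//.
  apply: eq_integral => w _; congr EFin; rewrite indicE.
  transitivity ((all (fun j => X j w \in B j) t)%:R : R).
    rewrite big_seq (eq_bigr (fun j => (X j w \in B j)%:R)); last first.
      by move=> j jt; rewrite (fB _ jt) indicE.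
    rewrite -big_seq; elim: (t) => [|j t' ih']; first by rewrite big_nil.
    by rewrite big_cons ih' /= -natrM mulnb.
  congr (nat_of_bool _)%:R; apply/allP/idP => [h|/set_mem h j jt].
    by rewrite inE => j /= /h /set_mem.
  by rewrite inE; exact: h.
move=> /andP[ist ust] mf f0 fv ft.
have fv' := ih t f v ust mf f0 fv ft.
apply: has_mean_ge0.
- by apply: measurable_prod => j _; exact: measurableT_comp.
- by move=> w; exact: prodr_ge0.
under eq_integral do rewrite big_cons mulrC.
(* The product over the other indices is the density [G], and its mean is the constant [c]. It
   remains to test against [\1_B (X i)]: this makes the factor at [i] an indicator and moves [i]
   from [s] to [t], where the induction hypothesis applies. *)
rewrite (@ge0_integral_density _ _ _ _ _ P (distribution P (X i)) _ _ _
  (\prod_(j <- s ++ t) v j))//.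
- rewrite ge0_integral_distribution//.
  + by rewrite [X in (_ * X)%E](fv i).2 big_cons mulrC EFinM.
  + by apply/measurable_EFinP.
  + by move=> y; rewrite lee_fin.
- exact: has_mean_measurable fv'.
- by move=> w; exact: prodr_ge0.
- by apply: prodr_ge0 => j _; apply: has_mean_mean_ge0 (fv j) => w.
move=> B mB.
pose f' j := if j == i then \1_B else f j.
pose v' j := if j == i then fine (P (X i @^-1` B)) else v j.
have pst : perm_eq (s ++ i :: t) (i :: s ++ t) by rewrite perm_catC /= perm_cons perm_catC.
have := ih (i :: t) f' v'.
rewrite (perm_uniq pst) /= ist ust => /(_ isT).
have -> : \prod_(j <- s ++ i :: t) v' j =
    \prod_(j <- s ++ t) v j * fine (P (X i @^-1` B)).
  rewrite (perm_big _ pst)/= big_cons {1}/v' eqxx mulrC; congr (_ * _).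
  rewrite big_seq [RHS]big_seq; apply: eq_bigr => j js; rewrite /v'.
  by case: eqP => // ji; rewrite -ji js in ist.
move=> [|||j|_]; last 1 first.
- rewrite EFinM fineK ?fin_num_measure//; last exact: measurable_funPTI.
  move=> <-; apply: eq_integral => w _; congr EFin.
  rewrite (perm_big _ pst)/= big_cons {1}/f' eqxx mulrC; congr (_ * _).
  rewrite big_seq [RHS]big_seq; apply: eq_bigr => j js; rewrite /f'.
  by case: eqP => // ji; rewrite -ji js in ist.
- by move=> j; rewrite /f'; case: ifP.
- by move=> j x; rewrite /f'; case: ifP.
- by move=> j; rewrite /f' /v'; case: eqP => [->|_] //; exact: has_mean_indic.
- rewrite inE /f'; case: eqP => [_ _|_ /= jt]; first by exists B.
  exact: ft.
Qed.

Lemma has_mean_prod_ge0 s f v : uniq s ->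
  (forall i, measurable_fun setT (f i)) -> (forall i x, 0 <= f i x) ->
  (forall i, has_mean P (fun w => f i (X i w)) (v i)) ->
  has_mean P (fun w => \prod_(i <- s) f i (X i w)) (\prod_(i <- s) v i).
Proof.
move=> us mf f0 fv.
by have := has_mean_prod_ge0_aux s [::] f v; rewrite cats0; exact.
Qed.

(** The product is linear in each factor, so signs can be removed one index at a time: writing [f i]
    as the difference of its positive and negative parts moves [i] from [s] to the nonnegative
    factors in [t]. *)
Let has_mean_prod_aux s t f v : uniq (s ++ t) ->
  (forall i, measurable_fun setT (f i)) ->
  (forall i, i \notin s -> forall x, 0 <= f i x) ->
  (forall i, has_mean P (fun w => f i (X i w)) (v i)) ->
  has_mean P (fun w => \prod_(i <- s ++ t) f i (X i w)) (\prod_(i <- s ++ t) v i).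
Proof.
elim: s t f v => [|i s ih] t f v /=.
  by move=> ut mf f0; apply: has_mean_prod_ge0 => // i x; exact: f0.
move=> /andP[ist ust] mf f0 fv.
have pst : perm_eq (s ++ i :: t) (i :: s ++ t) by rewrite perm_catC /= perm_cons perm_catC.
have [fpv [fpi fpvE]] : exists fpv, has_mean P (fun w => (f i)^\+ (X i w)) fpv.
  eexists; apply: integrable_has_mean.
  exact: (integrable_funrpos measurableT (fv i).1).
have [fnv [fni fnvE]] : exists fnv, has_mean P (fun w => (f i)^\- (X i w)) fnv.
  eexists; apply: integrable_has_mean.
  exact: (integrable_funrneg measurableT (fv i).1).
have viE : v i = fpv - fnv.
  apply: (has_mean_unique _ _ _ _ (fv i)).
  apply: has_mean_ext (has_meanB _ _ _ _ _ (conj fpi fpvE) (conj fni fnvE)) => w.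
  by rewrite -[in RHS](funrposBneg (f i)).
have key (g : R -> R) gv : measurable_fun setT g -> (forall x, 0 <= g x) ->
    has_mean P (fun w => g (X i w)) gv ->
    has_mean P (fun w => g (X i w) * \prod_(j <- s ++ t) f j (X j w))
               (gv * \prod_(j <- s ++ t) v j).
  move=> mg g0 ggv.
  pose f' j := if j == i then g else f j.
  pose v' j := if j == i then gv else v j.
  have := ih (i :: t) f' v'.
  rewrite (perm_uniq pst) /= ist ust => /(_ isT).
  rewrite (perm_big _ pst)/= big_cons [X in X * _]/v' eqxx => H.
  have vE : \prod_(j <- s ++ t) v' j = \prod_(j <- s ++ t) v j.
    rewrite big_seq [RHS]big_seq; apply: eq_bigr => j js; rewrite /v'.
    by case: eqP => // ji; rewrite -ji js in ist.
  rewrite vE in H; apply: has_mean_ext (H _ _ _).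
  - move=> w /=; rewrite (perm_big _ pst)/= big_cons {1}/f' eqxx; congr (_ * _).
    rewrite big_seq [RHS]big_seq; apply: eq_bigr => j js; rewrite /f'.
    by case: eqP => // ji; rewrite -ji js in ist.
  - by move=> j; rewrite /f'; case: ifP.
  - move=> j js x; rewrite /f'; case: eqP => // /eqP ji.
    by apply: f0; rewrite inE negb_or ji.
  - by move=> j; rewrite /f' /v'; case: eqP => [->|_].
rewrite big_cons viE mulrBl.
apply: has_mean_ext (has_meanB _ _ _ _ _
  (key (f i)^\+ fpv _ _ (conj fpi fpvE)) (key (f i)^\- fnv _ _ (conj fni fnvE))) => //.
- move=> w; rewrite big_cons -mulrBl; congr (_ * _).
  by rewrite -[in RHS](funrposBneg (f i)).
- exact: measurable_funrpos.
- exact: measurable_funrneg.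
Qed.

Lemma has_mean_prod s f v : uniq s -> (forall i, measurable_fun setT (f i)) ->
  (forall i, has_mean P (fun w => f i (X i w)) (v i)) ->
  has_mean P (fun w => \prod_(i <- s) f i (X i w)) (\prod_(i <- s) v i).
Proof.
move=> us mf fv.
(* The auxiliary statement wants nonnegativity at every index outside [s]; replacing those functions
   by zero secures it without changing the product over [s]. *)
pose f' i := if i \in s then f i else cst 0.
pose v' i := if i \in s then v i else 0.
have := has_mean_prod_aux s [::] f' v'; rewrite cats0.
have -> : \prod_(i <- s) v' i = \prod_(i <- s) v i.
  by rewrite big_seq [RHS]big_seq; apply: eq_bigr => i; rewrite /v' => ->.
move=> H; apply: has_mean_ext (H us _ _ _).
- move=> w; rewrite big_seq [RHS]big_seq; apply: eq_bigr => i; rewrite /f' => ->//.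
- by move=> i; rewrite /f'; case: ifP.
- by move=> i; rewrite /f' => /negbTE -> x.
- by move=> i; rewrite /f' /v'; case: ifP => // _; exact: has_mean0.
Qed.

End independent_products.

(** * Moments of centred Gaussians *)

Section gaussian_density.
Context {R : realType} (s : R).
Hypothesis s_gt0 : 0 < s.
Local Notation mu := (@lebesgue_measure R).
Local Notation g := (normal_pdf 0 s).

Let g_ge0 x : 0 <= g x. Proof. exact: normal_pdf_ge0. Qed.

Let mg : measurable_fun setT g. Proof. exact: measurable_normal_pdf. Qed.

Let s_neq0 : s != 0. Proof. by rewrite gt_eqF. Qed.

Let cg : continuous g. Proof. exact: continuous_normal_pdf. Qed.

Let gE x : g x = normal_peak s * expR (- (s ^+ 2 *+ 2)^-1 * x ^+ 2).
Proof.
rewrite normal_pdfE// /normal_fun subr0; congr (_ * expR _).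
by rewrite mulrC mulrN mulNr.
Qed.

Let gN x : g (- x) = g x. Proof. by rewrite !gE sqrrN. Qed.

Let is_derive_g (x : R) : is_derive x 1 g (- (s ^- 2 * x) * g x).
Proof.
pose q : R -> R := (- (s ^+ 2 *+ 2)^-1) \*: (id ^+ 2).
have -> : g = normal_peak s \*: (expR \o q).
  by apply/funext => y; rewrite gE.
have dq : is_derive x 1 q (- (s ^- 2 * x)).
  apply: is_derive_eq; rewrite /GRing.scale/=.
  by rewrite expr1 mulr1 -mulr_natr; field.
have dgq := is_deriveZ (normal_peak s) (is_derive1_comp (is_derive_expR (q x)) dq).
apply: is_derive_eq dgq _.
rewrite /=; change (normal_peak s * (expR (q x) * - (s ^- 2 * x)) =
  - (s ^- 2 * x) * (normal_peak s * expR (q x))); ring.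
Qed.

(** Integration by parts in antiderivative form: since [g' = - x g / s ^ 2], this function links the
    moments of order [k + 2] and [k]. *)
Let is_derive_gX k (x : R) : is_derive x 1 (fun x => - s ^+ 2 * (x ^+ k.+1 * g x))
   (x ^+ k.+2 * g x - k.+1%:R * s ^+ 2 * (x ^+ k * g x)).
Proof.
have -> : (fun x => - s ^+ 2 * (x ^+ k.+1 * g x)) = (- s ^+ 2) \*: ((@idfun R ^+ k.+1) * g).
  by apply/funext => y; rewrite !fctE.
have dX : is_derive x 1 (@id R ^+ k.+1) (k.+1%:R * x ^+ k).
  by apply: is_derive_eq (is_deriveX k.+1 (is_derive_id x 1)) _; rewrite [LHS]mulr1.
apply: is_derive_eq (is_deriveZ (- s ^+ 2) (is_deriveM dX (is_derive_g x))) _.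
change (- s ^+ 2 * ((@id R ^+ k.+1) x * (- (s ^- 2 * x) * g x) + g x * (k.+1%:R * x ^+ k)) =
   x ^+ k.+2 * g x - k.+1%:R * s ^+ 2 * (x ^+ k * g x)).
by rewrite !fctE !exprS; field.
Qed.

Let cgX k : continuous (fun x : R => x ^+ k * g x).
Proof. by move=> x; apply: cvgM; [exact: exprn_continuous|exact: cg]. Qed.

Let mgX k : measurable_fun setT (fun x : R => x ^+ k * g x).
Proof. exact: continuous_measurable_fun. Qed.

Let igX k (b : R) : mu.-integrable `[- b, b] (EFin \o (fun x : R => x ^+ k * g x)).
Proof.
apply: continuous_compact_integrable; first exact: segment_compact.
exact/continuous_subspaceT/cgX.
Qed.

Let A k (b : R) : R := (\int[mu]_(x in `[- b, b]) (x ^+ k * g x))%R.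

(** For even [k] the antiderivative is odd, so its two boundary values add up instead of cancelling;
    this is the origin of the factor 2. *)
Let A_rec k (b : R) : ~~ odd k -> 0 < b ->
  A k.+2 b = k.+1%:R * s ^+ 2 * A k b - 2 * s ^+ 2 * (b ^+ k.+1 * g b).
Proof.
move=> ek b0.
pose F (x : R) := - s ^+ 2 * (x ^+ k.+1 * g x).
have dF x : derivable F x 1 by exact: (@ex_derive _ _ _ _ _ _ _ (is_derive_gX k x)).
have cF x : F @ x --> F x.
  by apply: differentiable_continuous; apply/derivable1_diffP; exact: dF.
have bb : - b < b by lra.
have H : (\int[mu]_(x in `[(- b)%R, b]) (x ^+ k.+2 * g x - k.+1%:R * s ^+ 2 * (x ^+ k * g x))%:E
    = (F b)%:E - (F (- b))%:E)%E.
  apply: continuous_FTC2 => //.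
  - apply: continuous_subspaceT => x; apply: cvgB; first exact: cgX.
    by apply: cvgM; [exact: cvg_cst|exact: cgX].
  - split => [x _||]; first exact: dF.
    + exact/cvg_at_right_filter/cF.
    + exact/cvg_at_left_filter/cF.
  - by move=> x _; rewrite derive1E; apply: derive_val; exact: is_derive_gX.
have : (\int[mu]_(x in `[- b, b]) (x ^+ k.+2 * g x - k.+1%:R * s ^+ 2 * (x ^+ k * g x)))%R
    = F b - F (- b) by rewrite /Rintegral H.
rewrite RintegralB//; last exact: (integrableZl _ _ (igX k b)).
rewrite RintegralZl// -/(A _ _) -/(A _ _) /F gN exprNn -signr_odd /= ek expr1.
by move=> /eqP; rewrite subr_eq => /eqP ->; ring.
Qed.

(** Keeping the single term [y ^ (k + 2) / (k + 2)!] of the exponential series at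
    [y = n ^ 2 / (2 s ^ 2)] leaves a bound [K / n], since [n ^ (k + 1) / n ^ (2 k + 4) <= 1 / n]. *)
Let cvg_bound k : (n%:R : R) ^+ k.+1 * g n%:R @[n --> \oo] --> (0 : R).
Proof.
pose c : R := (s ^+ 2 *+ 2)^-1.
have c0 : 0 < c by rewrite invr_gt0 pmulrn_lgt0// exprn_gt0.
pose K : R := normal_peak s * k.+2`!%:R * c ^- k.+2.
have hK : K * n%:R^-1 @[n --> \oo] --> (0 : R).
  rewrite -[X in _ --> X](mulr0 K); apply: cvgM; first exact: cvg_cst.
  exact: cvgn_inv_natr.
apply: (@squeeze_cvgr _ _ _ _ (cst 0) (fun n => K * n%:R^-1)) => //; last exact: cvg_cst.
near=> n; apply/andP; split; first by rewrite mulr_ge0// exprn_ge0.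
have n0 : 0 < (n%:R : R) by rewrite ltr0n; near: n; exact: nbhs_infty_gt.
have n1 : 1 <= (n%:R : R) by rewrite ler1n -(ltr0n R).
have y0 : 0 < c * n%:R ^+ 2 by rewrite mulr_gt0// exprn_gt0.
have e1 : expR (- (c * n%:R ^+ 2)) <= k.+2`!%:R / (c * n%:R ^+ 2) ^+ k.+2.
  rewrite expRN -[leRHS]invf_div lef_pV2 ?posrE ?expR_gt0 ?divr_gt0 ?exprn_gt0 ?ltr0n ?fact_gt0//.
  by apply: le_trans (expR_ge1Dxn k.+1 (ltW y0)); rewrite lerDr.
rewrite gE -/c mulNr /K; apply: (@le_trans _ _
   (n%:R ^+ k.+1 * (normal_peak s * (k.+2`!%:R / (c * n%:R ^+ 2) ^+ k.+2)))).
  by rewrite ler_pM2l ?exprn_gt0// ler_wpM2l// normal_peak_ge0.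
have -> : n%:R ^+ k.+1 * (normal_peak s * (k.+2`!%:R / (c * n%:R ^+ 2) ^+ k.+2)) =
   normal_peak s * k.+2`!%:R * c ^- k.+2 * (n%:R^-1 * n%:R ^- k.+2) :> R.
  rewrite exprMn -exprM mul2n -addnn exprD invfM invfM (exprS n%:R k.+1).
  have c' : c ^+ k.+2 != 0 by rewrite expf_neq0// gt_eqF.
  have n' : (n%:R : R) ^+ k.+1 != 0 by rewrite expf_neq0// gt_eqF.
  have n0' : (n%:R : R) != 0 by rewrite gt_eqF.
  have c1 : c != 0 by rewrite gt_eqF.
  move: (c ^+ k.+2) c' (n%:R ^+ k.+1) n' => C C0 Nk Nk0; field.
  by apply/and4P; split => //; exact: (expf_neq0 k.+1 c1).
rewrite ler_wpM2l//.
  by rewrite !mulr_ge0 ?normal_peak_ge0// invr_ge0 exprn_ge0// ltW.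
by rewrite ler_piMr ?invr_ge0 ?(ltW n0)// invf_le1 ?exprn_gt0// exprn_ege1.
Unshelve. all: by end_near. Qed.

(** Evenness makes the integrand nonnegative, so the exhaustion by [[-n, n]] converges in the
    extended reals before integrability is known. *)
Let cvg_A k : ~~ odd k ->
  (A k n%:R)%:E @[n --> \oo] --> (\int[mu]_x (x ^+ k * g x)%:E)%E.
Proof.
move=> ek.
have h0 x : 0 <= x ^+ k * g x by rewrite mulr_ge0// exprn_even_ge0.
have AE n : (A k n%:R)%:E = (\int[mu]_(x in `[(- n%:R)%R, n%:R%R]) (x ^+ k * g x)%:E)%E.
  by rewrite /A /Rintegral fineK//; exact: integrable_fin_num (igX _ _).
under eq_fun do rewrite AE.
have -> : [set: R] = \bigcup_n `[- n%:R, n%:R]%classic.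
  apply/seteqP; split => // x _; exists (Num.truncn `|x|).+1 => //; rewrite /=.
  by rewrite in_itv/= -ler_norml; apply: ltW; exact: truncnS_gt.
apply: ge0_nondecreasing_set_cvg_integral.
- move=> m n mn; apply/subsetPset => x /=; rewrite !in_itv/= => /andP[mx xm].
  have : (m%:R : R) <= n%:R by rewrite ler_nat.
  by move=> ?; apply/andP; split; lra.
- by move=> n; exact: measurable_itv.
- move=> n; apply: measurable_funTS; apply/measurable_EFinP. exact: mgX.
- by move=> n x _; rewrite lee_fin.
Qed.

(** The truncated moments of order [k + 2] tend both to the integral and to the real number given by
    the recursion; uniqueness of limits thus transfers finiteness together with the value. *)
Let even_moment_rec k (m : R) : ~~ odd k -> (\int[mu]_x (x ^+ k * g x)%:E)%E = m%:E ->
  (\int[mu]_x (x ^+ k.+2 * g x)%:E)%E = (k.+1%:R * s ^+ 2 * m)%:E.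
Proof.
move=> ek km.
have Am : A k n%:R @[n --> \oo] --> m.
  by have := cvg_A k ek; rewrite km => /fine_cvgP[_]; exact.
have A2 : A k.+2 n%:R @[n --> \oo] --> k.+1%:R * s ^+ 2 * m.
  have : k.+1%:R * s ^+ 2 * A k n%:R - 2 * s ^+ 2 * (n%:R ^+ k.+1 * g n%:R) @[n --> \oo]
     --> k.+1%:R * s ^+ 2 * m - 2 * s ^+ 2 * 0.
    apply: cvgB; apply: cvgM; [exact: cvg_cst|exact: Am|exact: cvg_cst|exact: cvg_bound].
  rewrite mulr0 subr0; apply: cvg_trans; apply: near_eq_cvg; near=> n.
  by rewrite A_rec// ltr0n; near: n; exact: nbhs_infty_gt.
apply: cvg_unique (cvg_A k.+2 _) _; first exact: ereal_hausdorff.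
  by rewrite /= negbK.
by apply: cvg_EFin => //; exact: nearW.
Unshelve. all: by end_near. Qed.

Let moment0 : (\int[mu]_x (x ^+ 0 * g x)%:E)%E = 1%:E.
Proof. by under eq_integral do rewrite expr0 mul1r; rewrite integral_normal_pdf. Qed.

Lemma normal_moment2 : (\int[mu]_x (x ^+ 2 * g x)%:E)%E = (s ^+ 2)%:E.
Proof. by rewrite (even_moment_rec 0 1)// mul1r mulr1. Qed.

Lemma normal_moment4 : (\int[mu]_x (x ^+ 4 * g x)%:E)%E = (3 * s ^+ 4)%:E.
Proof.
by rewrite (even_moment_rec 2 (s ^+ 2))// ?normal_moment2// -mulrA -exprD.
Qed.

Lemma normal_moment_even k : exists m, (\int[mu]_x (x ^+ k.*2 * g x)%:E)%E = m%:E.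
Proof.
elim: k => [|k [m km]]; first by exists 1.
by exists (k.*2.+1%:R * s ^+ 2 * m); apply: even_moment_rec => //; rewrite odd_double.
Qed.

Lemma ge0_integral_normal_prob (f : R -> R) : measurable_fun setT f ->
  (forall x, 0 <= f x) ->
  (\int[normal_prob 0 s]_x (f x)%:E = \int[mu]_x (f x * g x)%:E)%E.
Proof.
move=> mf f0.
have := ge0_integral_density mu (normal_prob 0 s) g id f 1 mg _ mf g_ge0 f0 ler01.
rewrite mul1e => <- //.
  by apply: eq_integral => x _; rewrite mulrC.
move=> B mB; rewrite mul1e /normal_prob [RHS]integral_mkcond.
apply: eq_integral => x _; rewrite patchE indicE.
by case: (x \in B); rewrite ?mulr1 ?mulr0.
Qed.

Lemma ge0_integral_normal_probN (f : R -> R) : measurable_fun setT f ->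
  (forall x, 0 <= f x) ->
  (\int[normal_prob 0 s]_x (f (- x))%:E = \int[normal_prob 0 s]_x (f x)%:E)%E.
Proof.
move=> mf f0.
rewrite !ge0_integral_normal_prob//; last exact: measurableT_comp.
have mfg : measurable_fun setT (fun x : R => (f x * g x)%:E).
  by apply/measurable_EFinP/measurable_funM.
have mN : measurable_fun setT (-%R : measurableTypeR R -> measurableTypeR R).
  exact: oppr_measurable.
transitivity (\int[pushforward mu (-%R : _ -> measurableTypeR R)]_x (f x * g x)%:E)%E.
  rewrite ge0_integral_pushforward; first last.
  - by move=> x _; rewrite lee_fin mulr_ge0.
  - exact: mfg.
  - exact: measurableT.
  - exact: mN.
  by rewrite preimage_setT; apply: eq_integral => x _ /=; rewrite gN.
by apply: eq_measure_integral => B mB _; exact: lebesgue_measureN.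
Qed.

End gaussian_density.

Section gaussian_random_variable.
Context {d} {T : measurableType d} {R : realType} (P : probability T R).
Context (X : {RV P >-> R}) (var : R).
Hypotheses (var_gt0 : 0 < var) (lawX : has_normal_law X var).
Let s := Num.sqrt var.
Let s_gt0 : 0 < s. Proof. by rewrite sqrtr_gt0. Qed.

Let ge0_integral_law (f : R -> R) : measurable_fun setT f -> (forall x, 0 <= f x) ->
  (\int[P]_w (f (X w))%:E = \int[normal_prob 0 s]_x (f x)%:E)%E.
Proof.
move=> mf f0.
have mX : measurable_fun setT X by [].
rewrite -[RHS]mul1e.
rewrite -(ge0_integral_density P (normal_prob 0 s) (cst 1) X f 1)//.
  by apply: eq_integral => w _; rewrite mul1r.
move=> B mB; rewrite mul1e /= -lawX.
under eq_integral do rewrite mul1r.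
have mXB : measurable (X @^-1` B) by exact: measurable_funPTI.
rewrite -[LHS]/(\int[P]_w (\1_(X @^-1` B) w)%:E)%E integral_indic// setIT.
by [].
Qed.

Let has_mean_even k m :
  (\int[lebesgue_measure]_x (x ^+ k.*2 * normal_pdf 0 s x)%:E)%E = m%:E ->
  has_mean P (fun w => X w ^+ k.*2) m.
Proof.
move=> km; apply: has_mean_ge0.
- exact: measurable_funX.
- by move=> w; rewrite exprn_even_ge0// odd_double.
- have mX : measurable_fun [set: R] (fun x : R => x ^+ k.*2) by exact: exprn_measurable.
  have X0 (x : R) : 0 <= x ^+ k.*2 by rewrite exprn_even_ge0// odd_double.
  by rewrite (ge0_integral_law (fun x => x ^+ k.*2))// ge0_integral_normal_prob.
Qed.

Lemma gaussian_moment2 : has_mean P (fun w => X w ^+ 2) var.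
Proof.
by apply: (has_mean_even 1); rewrite normal_moment2// sqr_sqrtr// ltW.
Qed.

Lemma gaussian_moment4 : has_mean P (fun w => X w ^+ 4) (3 * var ^+ 2).
Proof.
apply: (has_mean_even 2); rewrite normal_moment4// (exprM s 2 2).
by rewrite sqr_sqrtr// ltW.
Qed.

(** The bound [|x| ^ k <= 1 + x ^ (2 k)] reduces all powers, odd ones included, to even moments. *)
Lemma gaussian_integrable k : P.-integrable setT (EFin \o (fun w => X w ^+ k)).
Proof.
have [m km] := normal_moment_even s s_gt0 k.
have [ik _] := has_meanD _ _ _ _ _ (has_mean_cst P 1) (has_mean_even k m km).
apply: le_integrable ik => //; first exact/measurable_EFinP/measurable_funX.
move=> w _; rewrite lee_fin; set x := X w.
have x2 : x ^+ k.*2 = `|x ^+ k| ^+ 2 by rewrite real_normK ?num_real// -exprM muln2.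
rewrite [leRHS]ger0_norm x2; last by rewrite addr_ge0// sqr_ge0.
have := sqr_ge0 (`|x ^+ k| - 1); have := normr_ge0 (x ^+ k); nra.
Qed.

(** For an odd power the negative part is the reflection of the positive part, and the centred
    Gaussian law is symmetric, so both parts have the same mean [p]. *)
Lemma gaussian_moment_odd k : odd k -> has_mean P (fun w => X w ^+ k) 0.
Proof.
move=> ok; have ik := gaussian_integrable k.
pose f (x : R) := x ^+ k.
have mf : measurable_fun setT f by exact: exprn_measurable.
have fN x : f^\- x = f^\+ (- x).
  by rewrite /funrneg /funrpos /f exprNn -signr_odd ok expr1 mulN1r.
have mfp : measurable_fun setT f^\+ by exact: measurable_funrpos.
have [p [pi pE]] : exists p, has_mean P (fun w => f^\+ (X w)) p.
  by eexists; apply: integrable_has_mean; exact: (integrable_funrpos measurableT ik).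
have hn : has_mean P (fun w => f^\- (X w)) p.
  split; first exact: (integrable_funrneg measurableT ik).
  rewrite -pE (ge0_integral_law f^\+)// (ge0_integral_law f^\-)//.
    by under eq_integral do rewrite fN; rewrite ge0_integral_normal_probN.
  exact: measurable_funrneg.
rewrite -(subrr p); apply: has_mean_ext (has_meanB _ _ _ _ _ (conj pi pE) hn) => w.
by rewrite -[RHS]/(f (X w)) -[in RHS](funrposBneg f).
Qed.

End gaussian_random_variable.

(** * Wick's formula and sums of squares of Gaussian forms *)

(** Case analysis on all coincidences among the indices, reusing decided equalities in either
    orientation; Wick's formula becomes one ring identity per pattern. *)
Ltac split_eqs := repeat (rewrite /=; match goal with
  | |- context [?a == ?a] => rewrite (eqxx a)
  | H : (?a == ?b) = false |- context [?a == ?b] => rewrite H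
  | H : (?a == ?b) = false |- context [?b == ?a] => rewrite (eq_sym b a) H
  | |- context [?a == ?b] => case: (eqVneq a b) => [?|/negPf ?]; [subst a|]
  end).

Section wick.
Context {d} {T : measurableType d} {R : realType} (P : probability T R).
Context {I : eqType} (X : I -> {RV P >-> R}) (var : I -> R).
Hypothesis var_gt0 : forall i, 0 < var i.
Hypothesis indX : mutually_independent X.
Hypothesis lawX : forall i, has_normal_law (X i) (var i).

(** Orders up to 4 are tabulated so that moments compute once multiplicities are known; higher
    orders keep the integral itself, which lets monomials of any degree be covered. *)
Let mom (i : I) (n : nat) : R :=
  match n with
  | 0 => 1 | 1 => 0 | 2 => var i | 3 => 0 | 4 => 3 * var i ^+ 2
  | _ => fine (\int[P]_w (X i w ^+ n)%:E)%E
  end.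

Let has_mean_mom i n : has_mean P (fun w => X i w ^+ n) (mom i n).
Proof.
move: n => [|[|[|[|[|n]]]]] /=.
- exact: has_mean_cst.
- exact: (gaussian_moment_odd _ _ _ (var_gt0 i) (lawX i) 1).
- exact: (gaussian_moment2 _ _ _ (var_gt0 i) (lawX i)).
- exact: (gaussian_moment_odd _ _ _ (var_gt0 i) (lawX i) 3).
- exact: (gaussian_moment4 _ _ _ (var_gt0 i) (lawX i)).
- by apply: integrable_has_mean; exact: (gaussian_integrable _ _ _ (var_gt0 i) (lawX i)).
Qed.

(** Equal factors are collected into powers, because independence speaks only of distinct
    indices. *)
Let has_mean_monomial (l : seq I) :
  has_mean P (fun w => \prod_(k <- l) X k w)
             (\prod_(k <- undup l) mom k (count_mem k l)).
Proof.
have := has_mean_prod P X indX (undup l) (fun k x => x ^+ count_mem k l)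
  (fun k => mom k (count_mem k l)) (undup_uniq l).
move=> H; apply: has_mean_ext (H _ _) => [w|i|i].
- exact: big_undup_iterop_count.
- exact: exprn_measurable.
- exact: has_mean_mom.
Qed.

Lemma gaussian_wick2 i j :
  has_mean P (fun w => X i w * X j w) ((i == j)%:R * var i).
Proof.
have := has_mean_monomial [:: i; j].
have -> : \prod_(k <- undup [:: i; j]) mom k (count_mem k [:: i; j]) =
    (i == j)%:R * var i.
  rewrite /= !inE; have [->|ij] := eqVneq i j.
    by rewrite big_seq1 /= !eqxx mul1r.
  by rewrite big_cons big_seq1 /= !eqxx (eq_sym j) (negbTE ij) /= !mul0r.
by apply: has_mean_ext => w; rewrite !big_cons big_nil mulr1.
Qed.

(** One term per pairing of the four factors. An index of odd multiplicity kills everything, two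
    distinct pairs leave a single pairing, and four equal indices satisfy all three, which matches
    the moment [3 * var ^ 2]. *)
Lemma gaussian_wick4 i j k l :
  has_mean P (fun w => X i w * X j w * (X k w * X l w))
    ((i == j)%:R * var i * ((k == l)%:R * var k) +
     (i == k)%:R * var i * ((j == l)%:R * var j) +
     (i == l)%:R * var i * ((j == k)%:R * var j)).
Proof.
have := has_mean_monomial [:: i; j; k; l].
have -> : \prod_(x <- undup [:: i; j; k; l]) mom x (count_mem x [:: i; j; k; l]) =
     (i == j)%:R * var i * ((k == l)%:R * var k) +
     (i == k)%:R * var i * ((j == l)%:R * var j) +
     (i == l)%:R * var i * ((j == k)%:R * var j).
  rewrite /= !inE.
  by split_eqs; rewrite !big_cons ?big_nil; split_eqs;
    rewrite /nat_of_bool ?(add0n, addn0, addSn) /mom /=; ring.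
by apply: has_mean_ext => w; rewrite !big_cons big_nil mulr1 !mulrA.
Qed.

End wick.

Lemma sum_delta {R : pzSemiRingType} {K : finType} (k : K) (f : K -> R) :
  \sum_l (k == l)%:R * f l = f k.
Proof.
rewrite (bigD1 k)//= eqxx mul1r big1 ?addr0// => l lk.
by rewrite eq_sym (negbTE lk) mul0r.
Qed.

Section gaussian_linear_forms.
Context {d} {T : measurableType d} {R : realType} (P : probability T R).
Context {I : eqType} (X : I -> {RV P >-> R}) (var : I -> R).
Hypothesis var_gt0 : forall i, 0 < var i.
Hypothesis indX : mutually_independent X.
Hypothesis lawX : forall i, has_normal_law (X i) (var i).
Context {K : finType} (e : K -> I).
Hypothesis inj_e : injective e.
Implicit Types a b : K -> R.

Definition linear_form a (w : T) : R := \sum_k a k * X (e k) w.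

Definition form_cov a b : R := \sum_k a k * b k * var (e k).

Local Notation L := linear_form.
Local Notation B := form_cov.

Lemma linear_form_mean2 a b : has_mean P (fun w => L a w * L b w) (B a b).
Proof.
have -> : B a b = \sum_k \sum_l a k * b l * ((e k == e l)%:R * var (e k)).
  apply: eq_bigr => k _; rewrite -[LHS](sum_delta k (fun l => a k * b l * var (e k))).
  by apply: eq_bigr => l _; rewrite (inj_eq inj_e); ring.
have := @has_mean_sum _ _ _ P K (index_enum K)
   (fun k w => \sum_l a k * b l * (X (e k) w * X (e l) w)) _
   (fun k => has_mean_sum P _ (index_enum K) _ _ (fun l => has_meanZ P _ _ (a k * b l)
      (gaussian_wick2 P X var var_gt0 indX lawX (e k) (e l)))).
apply: has_mean_ext => w; rewrite /L big_distrlr/=.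
by apply: eq_bigr => k _; apply: eq_bigr => l _; ring.
Qed.

Lemma linear_form_mean4 a b a' b' :
  has_mean P (fun w => L a w * L b w * (L a' w * L b' w))
    (B a b * B a' b' + B a a' * B b b' + B a b' * B b a').
Proof.
pose W k l m n : R := 
  ((k == l)%:R * var (e k) * ((m == n)%:R * var (e m)) +
   (k == m)%:R * var (e k) * ((l == n)%:R * var (e l)) +
   (k == n)%:R * var (e k) * ((l == m)%:R * var (e l))).
have -> : B a b * B a' b' + B a a' * B b b' + B a b' * B b a' =
    \sum_k \sum_l \sum_m \sum_n a k * b l * a' m * b' n * W k l m n.
  (* Each product of two covariances is only a double sum; [sum_delta] restores the two contracted
     indices, so that both sides become fourfold sums compared termwise. *)
  rewrite {1 3 5}/B !mulr_suml -!big_split/=; apply: eq_bigr => k _.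
  rewrite -[a k * b k * _ * _](sum_delta k (fun l => a k * b l * var (e k) * B a' b')).
  rewrite {2 3}/B !mulr_sumr -!big_split/=; apply: eq_bigr => l _.
  rewrite -[a k * a' k * _ * _](sum_delta k (fun m => a k * a' m * var (e k) *
    (b l * b' l * var (e l)))).
  rewrite -[a k * b' k * _ * _](sum_delta l (fun m => a k * b' k * var (e k) *
    (b l * a' m * var (e l)))).
  rewrite {1}/B !mulr_sumr -!big_split/=; apply: eq_bigr => m _.
  rewrite -[X in X + _ + _](sum_delta m (fun n => (k == l)%:R *
    (a k * b l * var (e k) * (a' m * b' n * var (e m))))).
  rewrite -[X in _ + X + _](sum_delta l (fun n => (k == m)%:R *
    (a k * a' m * var (e k) * (b l * b' n * var (e l))))).
  rewrite -[X in _ + _ + X](sum_delta k (fun n => (l == m)%:R *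
    (a k * b' n * var (e k) * (b l * a' m * var (e l))))).
  by rewrite -!big_split/=; apply: eq_bigr => n _; rewrite /W; ring.
have H k l m n : has_mean P (fun w => a k * b l * a' m * b' n *
    (X (e k) w * X (e l) w * (X (e m) w * X (e n) w)))
    (a k * b l * a' m * b' n * W k l m n).
  apply: has_meanZ; have := gaussian_wick4 P X var var_gt0 indX lawX (e k) (e l) (e m) (e n).
  by rewrite !(inj_eq inj_e).
have := has_mean_sum P _ (index_enum K) _ _ (fun k => has_mean_sum P _ (index_enum K) _ _
  (fun l => has_mean_sum P _ (index_enum K) _ _ (fun m => has_mean_sum P _ (index_enum K) _ _
  (fun n => H k l m n)))).
apply: has_mean_ext => w; rewrite /L big_distrlr/= [X in _ = _ * X]big_distrlr/=.
rewrite [RHS]big_distrl/=; apply: eq_bigr => k _.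
rewrite [RHS]big_distrl/=; apply: eq_bigr => l _.
rewrite [RHS]big_distrr/=; apply: eq_bigr => m _.
rewrite [RHS]big_distrr/=; apply: eq_bigr => n _.
by ring.
Qed.

Context {J : finType} (c : J -> K -> R).

Lemma sum_squares_mean :
  has_mean P (fun w => \sum_r L (c r) w ^+ 2) (\sum_r B (c r) (c r)).
Proof.
apply: has_mean_sum => r; apply: has_mean_ext (linear_form_mean2 (c r) (c r)) => w.
by rewrite expr2.
Qed.

(** Pairing each square with itself yields the squared mean; the two cross pairings coincide, whence
    the factor 2 in the variance. *)
Lemma sum_squares_mean2 :
  has_mean P (fun w => (\sum_r L (c r) w ^+ 2) ^+ 2)
    ((\sum_r B (c r) (c r)) ^+ 2 + 2 * \sum_r \sum_s B (c r) (c s) ^+ 2).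
Proof.
have -> : (\sum_r B (c r) (c r)) ^+ 2 + 2 * (\sum_r \sum_s B (c r) (c s) ^+ 2) =
   \sum_r \sum_s (B (c r) (c r) * B (c s) (c s) + B (c r) (c s) * B (c r) (c s) +
     B (c r) (c s) * B (c r) (c s)).
  rewrite expr2 big_distrlr/= mulr_sumr -big_split/=; apply: eq_bigr => r _.
  by rewrite mulr_sumr -big_split/=; apply: eq_bigr => s _; ring.
have := has_mean_sum P _ (index_enum J) _ _ (fun r => has_mean_sum P _ (index_enum J) _ _
  (fun s => linear_form_mean4 (c r) (c r) (c s) (c s))).
apply: has_mean_ext => w; rewrite [RHS]expr2 big_distrlr/=.
by apply: eq_bigr => r _; apply: eq_bigr => s _; rewrite !expr2.
Qed.

End gaussian_linear_forms.

Lemma has_mean_expectation {d} {T : measurableType d} {R : realType}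
    (P : probability T R) (f : T -> R) (m : R) :
  has_mean P f m -> ('E_P[f] = m%:E)%E.
Proof. by move=> [_ fm]; rewrite unlock. Qed.

Lemma has_mean_variance {d} {T : measurableType d} {R : realType}
    (P : probability T R) (f : T -> R) (m q : R) :
  has_mean P f m -> has_mean P (fun w => f w ^+ 2) q ->
  'V_P[f] = (q - m ^+ 2)%:E.
Proof.
move=> fm fq; rewrite /variance unlock (has_mean_expectation _ _ _ fm)/=.
apply: has_mean_expectation.
have := has_meanD _ _ _ _ _ (has_meanD _ _ _ _ _ fq (has_meanZ _ _ _ (- 2 * m) fm))
  (has_mean_cst P (m ^+ 2)).
have -> : q + (-2 * m) * m + m ^+ 2 = q - m ^+ 2 by ring.
by apply: has_mean_ext => w; rewrite !fctE /=; ring.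
Qed.

(** * A strong law of large numbers *)

Lemma nneseries_cvg0 {R : realType} (u : nat -> R) : (forall k, 0 <= u k) ->
  (\sum_(0 <= k <oo) (u k)%:E < +oo)%E -> u k @[k --> \oo] --> (0 : R).
Proof.
move=> u0 uoo.
have u0' k : xpredT k -> (0 <= (u k)%:E)%E by rewrite lee_fin.
have tail := nneseries_tail_cvg uoo u0'.
have : (u k)%:E @[k --> \oo] --> 0%:E.
  apply: (@squeeze_cvge _ _ _ _ (cst 0%E) _
    (fun N => \sum_(N <= k <oo) (u k)%:E)%E) => //; last exact: cvg_cst.
  apply: nearW => N; rewrite lee_fin u0/=.
  have := @nneseries_lim_ge R (fun k => (u k)%:E) xpredT N N.+1 (fun i _ _ => u0' i isT).
  by rewrite big_nat1.
by move=> /fine_cvgP[_]; exact.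
Qed.

(** Telescoping: with [x = n + 1], [1 / x ^ 2 <= 2 / x - 2 / (x + 1)] as soon as [x >= 1]; the
    factor 2 makes this valid from the first term on. *)
Lemma sum_inv_sqr_le {R : realFieldType} n :
  \sum_(0 <= k < n) (k.+1%:R ^- 2 : R) <= 2 - 2 * n.+1%:R^-1.
Proof.
elim: n => [|n ih]; first by rewrite big_geq// invr1 mulr1 subrr.
rewrite big_nat_recr//=; apply: le_trans (lerD ih (lexx _)) _.
have n0 : 0 < (n.+1%:R : R) by rewrite ltr0n.
have n1 : 1 <= (n.+1%:R : R) by rewrite ler1n.
rewrite -[n.+2]addn1 natrD; move: (n.+1%:R : R) n0 n1 => x x0 x1.
rewrite -subr_ge0.
have -> : 2 - 2 * (x + 1%:R)^-1 - (2 - 2 * x^-1 + x ^- 2) = (x - 1) / (x ^+ 2 * (x + 1)).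
  by field; rewrite !gt_eqF//; lra.
by apply: divr_ge0; [lra|apply: mulr_ge0; [exact: sqr_ge0|lra]].
Qed.

Section ae_cvg0.
Context {d} {T : measurableType d} {R : realType} (P : probability T R).

(** The series of the [F k] has finite mean, hence is finite almost everywhere, and the terms of a
    convergent series vanish in the limit. *)
Lemma ae_cvg0_of_means (F : nat -> T -> R) (v : nat -> R) (D : R) :
  (forall k w, 0 <= F k w) -> (forall k, has_mean P (F k) (v k)) ->
  (forall k, v k <= D * k.+1%:R ^- 2) ->
  {ae P, forall w, F k w @[k --> \oo] --> (0 : R)}.
Proof.
move=> F0 Fv vD.
have v0 k : 0 <= v k by exact: has_mean_mean_ge0 (F0 k) (Fv k).
have D0 : 0 <= D by have := le_trans (v0 0%N) (vD 0%N); rewrite expr1n invr1 mulr1.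
have mF k : measurable_fun setT (fun w => (F k w)%:E).
  by apply/measurable_EFinP; exact: has_mean_measurable (Fv k).
pose G w := (\sum_(0 <= k <oo) (F k w)%:E)%E.
have G0 w : (0 <= G w)%E by apply: nneseries_ge0 => k _ _; rewrite lee_fin.
have mG : measurable_fun setT G.
  by apply: ge0_emeasurable_sum => // k w _ _; rewrite lee_fin.
have iG : (\int[P]_w G w <= (2 * D)%:E)%E.
  rewrite integral_nneseries//; last by move=> k w _; rewrite lee_fin.
  under eq_eseriesr do rewrite (Fv _).2.
  apply: lime_le; first by apply: is_cvg_nneseries => k _ _; rewrite lee_fin.
  apply: nearW => n; rewrite sumEFin lee_fin.
  apply: (@le_trans _ _ (\sum_(0 <= k < n) D * k.+1%:R ^- 2)).
    by apply: ler_sum => k _; exact: vD.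
  rewrite -mulr_sumr mulrC ler_wpM2r//; apply: le_trans (sum_inv_sqr_le n) _.
  by rewrite gerBl mulr_ge0// invr_ge0.
have intG : P.-integrable setT G.
  apply/integrableP; split => //.
  under eq_integral do rewrite gee0_abs//.
  exact: le_lt_trans iG (ltry _).
have := integrable_ae measurableT intG.
apply: filterS => w /(_ Logic.I) Gw; apply: nneseries_cvg0 => //.
by rewrite -ge0_fin_numE//; exact: G0.
Qed.

End ae_cvg0.

Section strong_law.
Context {d} {T : measurableType d} {R : realType} (P : probability T R).
Context (Z : nat -> T -> R) (c : R).
Hypothesis ZZ : forall i j, has_mean P (fun w => Z i w * Z j w) ((i == j)%:R * c).

Let S m n w := \sum_(m <= i < n) Z i w.

Let S_mean2 m n : has_mean P (fun w => S m n w ^+ 2) ((n - m)%:R * c).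
Proof.
have := has_mean_sum P _ (index_iota m n) _ _ (fun i =>
  has_mean_sum P _ (index_iota m n) _ _ (fun j => ZZ i j)).
have -> : \sum_(i <- index_iota m n) \sum_(j <- index_iota m n) (i == j)%:R * c =
    (n - m)%:R * c.
  rewrite big_seq (eq_bigr (fun=> c)) => [|i im].
    by rewrite -big_seq big_const_nat iter_addr_0 mulr_natl.
  rewrite (bigD1_seq i)//= ?iota_uniq// eqxx mul1r big1 ?addr0// => j ji.
  by rewrite eq_sym (negbTE ji) mul0r.
by apply: has_mean_ext => w; rewrite expr2 /S big_distrlr.
Qed.

Let c_ge0 : 0 <= c.
Proof.
have := has_mean_mean_ge0 _ _ _ _ (S_mean2 0 1).
by rewrite subn0 mul1r; apply => w; exact: sqr_ge0.
Qed.

(* Second moments along the squares [K ^ 2], together with all the increments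
   inside the block from [K ^ 2] to [(K + 1) ^ 2], where [K = k + 1]. *)
Let F k w := k.+1%:R ^- 4 * (S 0 (k.+1 ^ 2) w ^+ 2 +
  \sum_(0 <= j < (2 * k.+1).+1) S (k.+1 ^ 2) (k.+1 ^ 2 + j) w ^+ 2).

Let v k := k.+1%:R ^- 4 * ((k.+1 ^ 2)%:R * c + \sum_(0 <= j < (2 * k.+1).+1) j%:R * c).

Let F_mean k : has_mean P (F k) (v k).
Proof.
apply: has_meanZ; apply: has_meanD.
  by have := S_mean2 0 (k.+1 ^ 2); rewrite subn0.
apply: has_mean_sum => j.
by have := S_mean2 (k.+1 ^ 2) (k.+1 ^ 2 + j); rewrite addKn.
Qed.

(** With [K = k + 1], the square contributes [K ^ 2] and the increments at most
    [(2 K + 1) * 3 K <= 9 K ^ 2], hence 10. Blocks between squares are short enough for the sum of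
    all squared increments to replace a maximal inequality. *)
Let v_le k : v k <= (10 * c) * k.+1%:R ^- 2.
Proof.
have k0 : 0 < (k.+1%:R : R) by rewrite ltr0n.
have k1 : 1 <= (k.+1%:R : R) by rewrite ler1n.
have h : \sum_(0 <= j < (2 * k.+1).+1) j%:R * c <= 9 * k.+1%:R ^+ 2 * c.
  apply: (@le_trans _ _ (\sum_(0 <= j < (2 * k.+1).+1) (3 * k.+1%:R) * c)).
    rewrite big_nat [leRHS]big_nat; apply: ler_sum => j /andP[_ jk].
    rewrite ler_wpM2r//.
    apply: (@le_trans _ _ ((2 * k.+1)%:R)); first by rewrite ler_nat.
    by rewrite natrM ler_wpM2r// ler_nat.
  rewrite big_const_nat iter_addr_0 subn0 -[_ *+ (2 * _).+1]mulr_natl mulrA ler_wpM2r//.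
  rewrite -addn1 natrD natrM.
  by move: (k.+1%:R : R) k0 k1 => x x0 x1; nra.
rewrite /v natrX mulrC ler_pdivrMr ?exprn_gt0//.
have -> : 10 * c / k.+1%:R ^+ 2 * k.+1%:R ^+ 4 = 10 * c * k.+1%:R ^+ 2 :> R.
  by field; rewrite gt_eqF.
have -> : 10 * c * k.+1%:R ^+ 2 = k.+1%:R ^+ 2 * c + 9 * k.+1%:R ^+ 2 * c by ring.
by rewrite lerD2l.
Qed.

Lemma floor_sqrt_ex m : exists K, (K ^ 2 <= m < K.+1 ^ 2)%N.
Proof.
elim: m => [|m [K /andP[Km mK]]]; first by exists 0%N.
have [|h] := ltnP m.+1 (K.+1 ^ 2); first by exists K; rewrite (leq_trans Km).
exists K.+1; rewrite h/=; apply: leq_ltn_trans mK _.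
by rewrite ltn_exp2r.
Qed.

Lemma strong_law_uncorrelated :
  {ae P, forall w, M%:R^-1 * (\sum_(m < M) Z m w) @[M --> \oo] --> (0 : R)}.
Proof.
have F0 k w : 0 <= F k w.
  rewrite mulr_ge0 ?invr_ge0 ?exprn_ge0// addr_ge0 ?sqr_ge0//.
  by apply: sumr_ge0 => j _; exact: sqr_ge0.
have := ae_cvg0_of_means P F v (10 * c) F0 F_mean v_le.
apply: filterS => w /cvgrPdist_lt Fw; apply/cvgrPdist_lt => eps eps0.
(* The half absorbs the 2 in [(A + B) ^ 2 <= 2 (A ^ 2 + B ^ 2)], where [A] is the sum up to the last
   square and [B] the remainder. *)
have eps2 : 0 < eps ^+ 2 / 2 by rewrite divr_gt0// exprn_gt0.
have [k0 _ hk0] := Fw _ eps2.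
(* If [K] is the integer square root of [M], this threshold forces [K > k0], so [K = k + 1] with
   [k >= k0]. *)
exists (k0.+2 ^ 2)%N => //= M Mk0.
have [K /andP[KM MK]] := floor_sqrt_ex M.
have K0 : (k0 < K)%N.
  have : (k0.+2 ^ 2 < K.+1 ^ 2)%N by exact: leq_ltn_trans Mk0 MK.
  by rewrite ltn_exp2r//; lia.
case: K K0 KM MK => // k k0k KM MK.
have := hk0 k k0k; rewrite /= !sub0r !normrN ger0_norm// => Fk.
have M0 : 0 < (M%:R : R) by rewrite ltr0n (leq_trans _ KM)// expn_gt0.
pose j := (M - k.+1 ^ 2)%N.
have jk : (j < (2 * k.+1).+1)%N by rewrite /j; lia.
have Mj : M = (k.+1 ^ 2 + j)%N by rewrite subnKC.
pose A := S 0 (k.+1 ^ 2) w; pose B := S (k.+1 ^ 2) M w.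
have SAB : \sum_(m < M) Z m w = A + B.
  by rewrite -(big_mkord xpredT (fun m => Z m w)) /A /B /S -big_cat_nat.
(* [M] lies in the block starting at [(k + 1) ^ 2], so [B ^ 2] is one of the nonnegative increments
   summed in [F k]. *)
have AB : A ^+ 2 + B ^+ 2 <= k.+1%:R ^+ 4 * F k w.
  rewrite /F mulrA divff ?mul1r ?expf_neq0// lerD2l.
  rewrite (big_rem j)/=; last by rewrite mem_index_iota.
  by rewrite -Mj lerDl; apply: sumr_ge0 => i _; exact: sqr_ge0.
have Kle : (k.+1%:R ^+ 4 : R) <= M%:R ^+ 2.
  by rewrite -!natrX ler_nat (expnM _ 2 2) leq_exp2r.
rewrite -(ltr_pXn2r (n := 2))// ?nnegrE//; last exact: ltW.
rewrite real_normK ?num_real// SAB exprMn exprVn mulrC ltr_pdivrMr ?exprn_gt0//.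
apply: (@le_lt_trans _ _ (2 * (k.+1%:R ^+ 4 * F k w))).
  by apply: le_trans (ler_wpM2l _ AB) => //; have := sqr_ge0 (A - B); nra.
apply: (@le_lt_trans _ _ (2 * (M%:R ^+ 2 * F k w))).
  by rewrite ler_wpM2l// ler_wpM2r.
have : M%:R ^+ 2 * F k w < M%:R ^+ 2 * (eps ^+ 2 / 2) by rewrite ltr_pM2l// exprn_gt0.
by move=> ?; lra.
Qed.

End strong_law.

(** * The deflection for a fixed channel *)

Lemma big_option {R : nmodType} {A : finType} (F : option A -> R) :
  \sum_o F o = F None + \sum_a F (Some a).
Proof. by rewrite ![index_enum _]unlock [@Finite.enum in LHS]unlock/= big_cons big_map. Qed.

Lemma sum_pair {R : nmodType} {A B : finType} (F : A * B -> R) :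
  \sum_p F p = \sum_a \sum_b F (a, b).
Proof. by rewrite pair_bigA; apply: eq_bigr => -[]. Qed.

Lemma sum_bool {R : nmodType} (F : bool -> R) : \sum_b F b = F true + F false.
Proof. exact: big_bool. Qed.

(* The real 2x2 matrix of the multiplication by [z], with [true] indexing the
   real part and [false] the imaginary part. *)
Definition cmat {R : realType} (z : R[i]) (c b : bool) : R :=
  if c then (if b then complex.Re z else - complex.Im z)
  else (if b then complex.Im z else complex.Re z).

Section complex_matrix.
Context {R : realType}.
Implicit Types (z : R[i]) (c b : bool).

Lemma cmatD z1 z2 c b : cmat (z1 + z2) c b = cmat z1 c b + cmat z2 c b.
Proof. by case: z1 => ? ?; case: z2 => ? ?; case: c; case: b => //=; rewrite opprD. Qed.

Lemma cmat0 c b : cmat (0 : R[i]) c b = 0.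
Proof. by case: c; case: b => //=; rewrite oppr0. Qed.

Lemma cmat_sum (I : Type) (r : seq I) (F : I -> R[i]) c b :
  cmat (\sum_(i <- r) F i) c b = \sum_(i <- r) cmat (F i) c b.
Proof.
elim: r => [|i r ih]; first by rewrite !big_nil cmat0.
by rewrite !big_cons cmatD ih.
Qed.

Lemma cmatM z1 z2 c b : cmat (z1 * z2) c b = \sum_e cmat z1 c e * cmat z2 e b.
Proof.
rewrite sum_bool; case: z1 => x1 y1; case: z2 => x2 y2.
by case: c; case: b => /=; ring.
Qed.

Lemma cmat_scale z (r : R) c b : cmat (z * r%:C%C) c b = cmat z c b * r.
Proof.
rewrite cmatM sum_bool; case: z => x y.
by case: c; case: b => /=; ring.
Qed.

Lemma cabs2_cmat z b : cabs2 z = \sum_c cmat z c b ^+ 2.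
Proof. by rewrite sum_bool /cabs2; case: b => /=; rewrite ?sqrrN // addrC. Qed.

(** Multiplication by [z] is a similarity: its two columns are orthogonal with the same squared
    norm. This later makes the phases of [a] disappear. *)
Lemma cmat_gram z b b' : \sum_c cmat z c b * cmat z c b' = (b == b')%:R * cabs2 z.
Proof.
by rewrite sum_bool /cabs2; case: b; case: b' => /=; ring.
Qed.

End complex_matrix.

(* Both sides are [tr ((G S G^T + t I)^2)], the right one expanded by cyclicity
   of the trace through the Gram matrix [G^T G]. *)
Lemma sum_sqr_gram {R : comRingType} {J K : finType} (g : J -> K -> R) (s : K -> R) (t : R) :
  \sum_r \sum_r' ((\sum_k g r k * g r' k * s k) + (r == r')%:R * t) ^+ 2 =
  \sum_k \sum_l s k * s l * (\sum_r g r k * g r l) ^+ 2 +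
  2 * t * (\sum_k s k * \sum_r g r k * g r k) + #|J|%:R * t ^+ 2.
Proof.
have E1 : \sum_r \sum_r' (\sum_k g r k * g r' k * s k) ^+ 2 =
    \sum_k \sum_l s k * s l * (\sum_r g r k * g r l) ^+ 2.
  under eq_bigr => r _ do under eq_bigr => r' _ do rewrite expr2 big_distrlr/=.
  under [RHS]eq_bigr => k _ do under eq_bigr => l _ do
    rewrite expr2 big_distrlr/= mulr_sumr.
  under [LHS]eq_bigr => r _ do rewrite exchange_big/=.
  rewrite exchange_big/=; apply: eq_bigr => k _.
  under [LHS]eq_bigr => r _ do rewrite exchange_big/=.
  rewrite exchange_big/=; apply: eq_bigr => l _.
  apply: eq_bigr => r _; rewrite mulr_sumr; apply: eq_bigr => r' _; ring.
have E2 : \sum_r \sum_r' (\sum_k g r k * g r' k * s k) * ((r == r')%:R * t) =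
    t * (\sum_k s k * \sum_r g r k * g r k).
  rewrite mulr_sumr; under [RHS]eq_bigr => k _ do rewrite !mulr_sumr.
  rewrite [RHS]exchange_big/=; apply: eq_bigr => r _.
  transitivity (\sum_r' (r == r')%:R * ((\sum_k g r k * g r' k * s k) * t)).
    by apply: eq_bigr => r' _; ring.
  rewrite sum_delta mulr_suml; apply: eq_bigr => k _; ring.
have E3 : \sum_(r : J) \sum_(r' : J) ((r == r')%:R * t) ^+ 2 = #|J|%:R * t ^+ 2.
  rewrite (eq_bigr (fun=> t ^+ 2)) => [|r _].
    by rewrite sumr_const mulr_natl.
  rewrite -[RHS](sum_delta r (fun=> t ^+ 2)); apply: eq_bigr => r' _.
  by case: (r == r') => /=; ring.
rewrite -E1 -E3 -mulrA -E2 mulr_sumr -!big_split/=; apply: eq_bigr => r _.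
rewrite mulr_sumr -!big_split/=; apply: eq_bigr => r' _; ring.
Qed.

Section deflection_formula.
Context {R : realType} {N : nat} (sth2 sn2 : R) (sv2 : 'I_N -> R).
Hypotheses (sth2_gt0 : 0 < sth2) (sn2_gt0 : 0 < sn2) (sv2_gt0 : forall i, 0 < sv2 i).
Context {d} {T : measurableType d} (Q : probability T R).
Context (th : bool -> {RV Q >-> R}) (v : 'I_N -> bool -> {RV Q >-> R})
  (n : nat -> bool -> {RV Q >-> R}).
Hypothesis ind : mutually_independent (noise_family th v n).
Hypothesis th_law : forall b, has_normal_law (th b) (sth2 / 2).
Hypothesis v_law : forall i b, has_normal_law (v i b) (sv2 i / 2).
Hypothesis n_law : forall m b, has_normal_law (n m b) (sn2 / 2).
Context (H : nat -> 'I_N -> R[i]) (M : nat) (a : 'I_N -> R[i]).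

Let noise_var (k : option ('I_N + nat) * bool) : R :=
  match k.1 with
  | None => sth2 / 2 | Some (inl i) => sv2 i / 2 | Some (inr _) => sn2 / 2
  end.

Let noise_var_gt0 k : 0 < noise_var k.
Proof. by case: k => [[[i|m]|] b]; rewrite divr_gt0. Qed.

Let noise_law k : has_normal_law (noise_family th v n k) (noise_var k).
Proof. by case: k => [[[i|m]|] b]; [exact: v_law|exact: n_law|exact: th_law]. Qed.

(** Sums over forms need a finite index type, while the noise family is infinite; only the first [M]
    receiver noises enter the statistic. *)
Let emb (k : option ('I_N + 'I_M) * bool) : option ('I_N + nat) * bool :=
  (match k.1 with
   | None => None | Some (inl i) => Some (inl i) | Some (inr m) => Some (inr (m : nat))
   end, k.2).

Let emb_inj : injective emb.
Proof.
move=> [[[i|m]|] b] [[[j|l]|] b'] //=; rewrite /emb/=.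
- by move=> [-> ->].
- by move=> [/val_inj -> ->].
- by move=> [->].
Qed.

(** The real [2M x 2N] matrix [G] of [H D], indexed by antenna or sensor and by real or imaginary
    component. *)
Definition channel_row (r : 'I_M * bool) (k : 'I_N * bool) : R :=
  cmat (H r.1 k.1 * a k.1) r.2 k.2.

Definition channel_gram (k l : 'I_N * bool) : R :=
  \sum_r channel_row r k * channel_row r l.

(** Coefficients of the real component [r] of the received vector in terms of signal, sensor noise
    and receiver noise. *)
Let coef (hyp1 : bool) (r : 'I_M * bool) (k : option ('I_N + 'I_M) * bool) : R :=
  match k.1 with
  | None => if hyp1 then cmat (\sum_i H r.1 i * a i) r.2 k.2 else 0
  | Some (inl i) => channel_row r (i, k.2)
  | Some (inr m) => (r == (m, k.2))%:R
  end.

Let sum_noise (F : option ('I_N + 'I_M) * bool -> R) :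
  \sum_k F k = \sum_b F (None, b) +
    (\sum_k F (Some (inl k.1), k.2) + \sum_r F (Some (inr r.1), r.2)).
Proof. by rewrite !sum_pair/= big_option big_sumType. Qed.

Let cmat_cRV (X : bool -> {RV Q >-> R}) w e : cmat (cRV X w) e true = X e w.
Proof. by case: e. Qed.

(** The column [true] of [cmat] holds the real and imaginary parts, so complex products become
    matrix products and each squared modulus becomes two squares of forms. *)
Let energy_statE hyp1 w : energy_stat th v n H M a hyp1 w =
  M%:R^-1 * \sum_r linear_form Q (noise_family th v n) emb (coef hyp1 r) w ^+ 2.
Proof.
rewrite /energy_stat sum_pair; congr (_ * _); apply: eq_bigr => m _.
rewrite (cabs2_cmat _ true); apply: eq_bigr => c _; congr (_ ^+ 2).
rewrite !cmatD cmat_sum cmat_cRV /linear_form sum_noise -addrA; congr (_ + (_ + _)).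
- rewrite /coef/=; case: hyp1.
    by rewrite cmatM; apply: eq_bigr => e _; rewrite cmat_cRV.
  by rewrite cmat0 big1// => b _; rewrite mul0r.
- rewrite sum_pair; apply: eq_bigr => i _; rewrite mulrA cmatM.
  by apply: eq_bigr => b _; rewrite cmat_cRV.
- rewrite /coef/= -[LHS](sum_delta (m, c) (fun r => n r.1 r.2 w)).
  by apply: eq_bigr => -[m' b] _.
Qed.

Local Notation C hyp1 := (fun r s => form_cov noise_var emb (coef hyp1 r) (coef hyp1 s)).

Let cov0E r s : C false r s =
  \sum_k channel_row r k * channel_row s k * (sv2 k.1 / 2) + (r == s)%:R * (sn2 / 2).
Proof.
rewrite /form_cov sum_noise big1 ?add0r => [|b _]; last by rewrite /= !mul0r.
congr (_ + _).
rewrite eq_sym -[RHS](sum_delta r (fun r' => (s == r')%:R * (sn2 / 2))).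
by apply: eq_bigr => -[m b] _; rewrite [RHS]mulrA.
Qed.

Let cov1E r : C true r r = C false r r +
  \sum_b cmat (\sum_i H r.1 i * a i) r.2 b ^+ 2 * (sth2 / 2).
Proof.
rewrite /form_cov !sum_noise [in RHS]big1 ?add0r => [|b _]; last by rewrite /= !mul0r.
by rewrite [LHS]addrC; congr (_ + _); apply: eq_bigr => b _; rewrite expr2.
Qed.

Let mean hyp1 : has_mean Q (energy_stat th v n H M a hyp1)
  (M%:R^-1 * \sum_r C hyp1 r r).
Proof.
apply: has_mean_ext (has_meanZ _ _ _ M%:R^-1
  (sum_squares_mean Q _ _ noise_var_gt0 ind noise_law emb emb_inj (coef hyp1))) => w.
by rewrite energy_statE.
Qed.

Let mean_sqr hyp1 : has_mean Q (fun w => energy_stat th v n H M a hyp1 w ^+ 2)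
  (M%:R^-1 ^+ 2 * ((\sum_r C hyp1 r r) ^+ 2 + 2 * \sum_r \sum_s C hyp1 r s ^+ 2)).
Proof.
apply: has_mean_ext (has_meanZ _ _ _ (M%:R^-1 ^+ 2)
  (sum_squares_mean2 Q _ _ noise_var_gt0 ind noise_law emb emb_inj (coef hyp1))) => w.
by rewrite energy_statE exprMn.
Qed.

(** The double sum over [true] columns is the squared norm of [H a], the only trace of the signal in
    the difference of means. *)
Lemma deflectionE : deflection th v n H M a =
  (M%:R^-1 * (sth2 * \sum_i \sum_j channel_gram (i, true) (j, true))) ^+ 2 /
  (M%:R^-1 ^+ 2 * (2 * \sum_k \sum_l sv2 k.1 / 2 * (sv2 l.1 / 2) * channel_gram k l ^+ 2
    + 2 * sn2 * \sum_k sv2 k.1 / 2 * channel_gram k k + M%:R * sn2 ^+ 2)).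
Proof.
rewrite /deflection (has_mean_expectation _ _ _ (mean true)).
rewrite (has_mean_expectation _ _ _ (mean false)).
rewrite (has_mean_variance _ _ _ _ (mean false) (mean_sqr false)) /=.
congr (_ ^+ 2 / _).
  rewrite -mulrBr; congr (_ * _).
  under eq_bigr do rewrite cov1E; rewrite big_split/= [LHS]addrC addKr.
  rewrite sum_pair/=.
  have -> : \sum_i \sum_j channel_gram (i, true) (j, true) =
      \sum_(m < M) cabs2 (\sum_i H m i * a i).
    under eq_bigr => i _ do under eq_bigr => j _ do rewrite /channel_gram sum_pair/=.
    under eq_bigr => i _ do rewrite exchange_big/=.
    rewrite exchange_big/=; apply: eq_bigr => m _.
    rewrite (cabs2_cmat _ true).
    under eq_bigr => i _ do rewrite exchange_big/=.
    rewrite exchange_big/=; apply: eq_bigr => c _.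
    by rewrite cmat_sum expr2 big_distrlr.
  rewrite mulr_sumr; apply: eq_bigr => m _.
  rewrite exchange_big/= (eq_bigr (fun=> cabs2 (\sum_i H m i * a i) * (sth2 / 2))).
    by rewrite sum_bool; field.
  by move=> b _; rewrite -mulr_suml (cabs2_cmat _ b).
(* The squared mean cancels. The remaining covariance matrix is [G S G^T + (sn2 / 2) I] of size
   [2M], and [2 * 2M * (sn2 / 2) ^ 2] gives [M * sn2 ^ 2]. *)
rewrite exprMn -mulrBr; congr (_ * _); rewrite [LHS]addrC addKr.
under eq_bigr => r _ do under eq_bigr => s _ do rewrite cov0E.
rewrite sum_sqr_gram card_prod card_ord card_bool natrM -/channel_gram.
rewrite !mulrDr; congr (_ + _ + _).
  by rewrite !mulrA; congr (_ * _); field.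
by field.
Qed.

End deflection_formula.

(** * Almost sure limits *)

Lemma cvg_sumr {R : realType} (I : Type) (r : seq I) (F : I -> nat -> R) (l : I -> R) :
  (forall i, F i n @[n --> \oo] --> l i) ->
  \sum_(i <- r) F i n @[n --> \oo] --> \sum_(i <- r) l i.
Proof. by move=> Fl; apply: cvg_big => // x; exact: add_continuous. Qed.

Lemma cvg0_mul_bounded {R : realType} (u v : nat -> R) (B : R) :
  u n @[n --> \oo] --> (0 : R) -> (\forall n \near \oo, `|v n| <= B) ->
  u n * v n @[n --> \oo] --> (0 : R).
Proof.
move=> u0 vB; apply/norm_cvg0P.
apply: (@squeeze_cvgr _ _ _ _ (cst 0) (fun n => `|u n| * B)).
- by near=> n; rewrite normr_ge0 normrM ler_wpM2l//; near: n.
- exact: cvg_cst.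
- rewrite -(mul0r B); apply: cvgM; last exact: cvg_cst.
  by rewrite -(normr0 R); apply: cvg_norm.
Unshelve. all: by end_near. Qed.

(** * Law of large numbers for products of channel coefficients *)

Section channel_averages.
Context {R : realType} {N : nat} {d} {T : measurableType d} (P : probability T R).
Context (h : nat -> 'I_N -> bool -> {RV P >-> R}).
Hypothesis ind : mutually_independent (fun k : nat * 'I_N * bool => h k.1.1 k.1.2 k.2).
Hypothesis law : forall m i b, has_normal_law (h m i b) (1 / 2).

Let X (k : nat * 'I_N * bool) := h k.1.1 k.1.2 k.2.
Let half_gt0 (k : nat * 'I_N * bool) : (0 : R) < 1 / 2. Proof. by []. Qed.
Let X_law k : has_normal_law (X k) (1 / 2). Proof. exact: law. Qed.

Lemma ae_channel_average i b j b' :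
  {ae P, forall w, M%:R^-1 * (\sum_(m < M) h m i b w * h m j b' w) @[M --> \oo] -->
    (((i, b) == (j, b'))%:R / 2 : R)}.
Proof.
pose delta : R := ((i, b) == (j, b'))%:R.
have dd : delta * delta = delta by rewrite /delta -natrM mulnb andbb.
pose Z m w := h m i b w * h m j b' w - delta / 2.
(* By Wick, a product of two [N(0, 1/2)] variables has variance [1/4] if they are distinct and [1/2]
   if they are equal; for [l] different from [m] the pairings across vanish. *)
have ZZ l m : has_mean P (fun w => Z l w * Z m w) ((l == m)%:R * ((1 + delta) / 4)).
  have W4 := gaussian_wick4 P X _ half_gt0 ind X_law (l, i, b) (l, j, b') (m, i, b) (m, j, b').
  have W2 m' := gaussian_wick2 P X _ half_gt0 ind X_law (m', i, b) (m', j, b').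
  have dE m' : ((m', i, b) == (m', j, b'))%:R = delta.
    by rewrite /delta !xpair_eqE eqxx.
  have E1 : ((l, i, b) == (m, j, b'))%:R = (l == m)%:R * delta.
    by rewrite /delta !xpair_eqE -natrM mulnb andbA.
  have E2 : ((l, j, b') == (m, i, b))%:R = (l == m)%:R * delta.
    by rewrite /delta !xpair_eqE -natrM mulnb (eq_sym j) (eq_sym b') andbA.
  have E3 : ((l, i, b) == (m, i, b)) = (l == m) by rewrite !xpair_eqE !eqxx !andbT.
  have E4 : ((l, j, b') == (m, j, b')) = (l == m) by rewrite !xpair_eqE !eqxx !andbT.
  rewrite !dE E1 E2 E3 E4 in W4.
  have := has_meanD _ _ _ _ _ (has_meanD _ _ _ _ _ W4 (has_meanZ _ _ _ (- (delta / 2))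
    (has_meanD _ _ _ _ _ (W2 l) (W2 m)))) (has_mean_cst P (delta ^+ 2 / 4)).
  rewrite !dE.
  have -> : delta * (1 / 2) * (delta * (1 / 2)) + (l == m)%:R * (1 / 2) * ((l == m)%:R * (1 / 2)) +
     (l == m)%:R * delta * (1 / 2) * ((l == m)%:R * delta * (1 / 2)) +
     - (delta / 2) * (delta * (1 / 2) + delta * (1 / 2)) + delta ^+ 2 / 4 =
     (l == m)%:R * (l == m)%:R * ((1 + delta * delta) / 4) by field.
  rewrite dd -natrM mulnb andbb.
  by apply: has_mean_ext => w; rewrite /Z /X/=; field.
have := strong_law_uncorrelated P Z _ ZZ.
apply: filterS => w Zw.
have : M%:R^-1 * (\sum_(m < M) Z m w) + delta / 2 @[M --> \oo] --> 0 + delta / 2.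
  by apply: cvgD; [exact: Zw|exact: cvg_cst].
rewrite add0r; apply: cvg_trans; apply: near_eq_cvg; near=> M.
have M0 : (M%:R : R) != 0 by rewrite pnatr_eq0 -lt0n; near: M; exact: nbhs_infty_gt.
rewrite /Z big_split/= sumrN sumr_const card_ord mulrBr.
by rewrite -[(_ / _) *+ M]mulr_natl [M%:R^-1 * (M%:R * _)]mulrA mulVf// mul1r subrK.
Unshelve. all: by end_near. Qed.

(** There are finitely many index tuples, so a single null set serves them all. *)
Lemma ae_channel_averages :
  {ae P, forall w, forall i b j b', M%:R^-1 * (\sum_(m < M) h m i b w * h m j b' w)
    @[M --> \oo] --> (((i, b) == (j, b'))%:R / 2 : R)}.
Proof.
apply: filter_forall => i; apply: filter_forall => b.
apply: filter_forall => j; apply: filter_forall => b'.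
exact: ae_channel_average.
Qed.

End channel_averages.

(** * The scaled Gram matrix for one good channel realisation *)

Section gram_limit.
Context {R : realType} {N : nat} (alpha : R) (dist Pw : 'I_N -> R).
Hypotheses (dist_gt0 : forall i, 0 < dist i).
Context (a : nat -> 'I_N -> R[i]).
Hypothesis aE : forall M, (0 < M)%N -> forall i, cabs2 (a M i) = Pw i / Num.sqrt M%:R.
Context {d} {T : measurableType d} (P : probability T R).
Context (h : nat -> 'I_N -> bool -> {RV P >-> R}) (w : T).
Hypothesis hw : forall i b j b',
  M%:R^-1 * (\sum_(m < M) h m i b w * h m j b' w) @[M --> \oo] --> (((i, b) == (j, b'))%:R / 2 : R).

Let q i : R := (Num.sqrt (dist i `^ alpha))^-1.

Let q_ge0 i : 0 <= q i. Proof. by rewrite invr_ge0 sqrtr_ge0. Qed.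

Let q_sqr i : q i * q i = (dist i `^ alpha)^-1.
Proof. by rewrite -expr2 exprVn sqr_sqrtr// powR_ge0. Qed.

Let D i e j e' M : R := M%:R^-1 *
  \sum_(m < M) \sum_c cmat (cRV (h m i) w) c e * cmat (cRV (h m j) w) c e'.

Let D_cvg i e j e' : D i e j e' M @[M --> \oo] --> (((i, e) == (j, e'))%:R : R).
Proof.
(* Each entry of [cmat] is, up to this sign, the component [c == e]; on the diagonal the two rows
   contribute [1/2] each. *)
pose sg (c e : bool) : R := if c && ~~ e then -1 else 1.
have cmE m i' c e0 : cmat (cRV (h m i') w) c e0 = sg c e0 * h m i' (c == e0) w.
  by rewrite /sg; case: c; case: e0 => /=; rewrite ?mul1r ?mulN1r.
have -> : (((i, e) == (j, e'))%:R : R) =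
    \sum_c sg c e * sg c e' * (((i, c == e) == (j, c == e'))%:R / 2).
  rewrite sum_bool /sg !xpair_eqE; case: (i == j) => /=; last by rewrite !mul0r !mulr0 addr0.
  by case: e; case: e' => /=; field.
have -> : D i e j e' = (fun M => \sum_c sg c e * sg c e' *
    (M%:R^-1 * (\sum_(m < M) h m i (c == e) w * h m j (c == e') w))).
  apply/funext => M; rewrite /D exchange_big/= mulr_sumr; apply: eq_bigr => c _.
  rewrite mulrCA; congr (_ * _); rewrite mulr_sumr; apply: eq_bigr => m _.
  by rewrite !cmE; ring.
by apply: cvg_sumr => c; apply: cvgM; [exact: cvg_cst|exact: hw].
Qed.

(** Entries of [a M] are of size at most [M ^ (-1/4)], so the factor [sqrt M] keeps their products
    bounded, by [|x y| <= (x ^ 2 + y ^ 2) / 2]; convergence may fail because of the phases. *)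
Let U i e b j e' b' M : R := 
  q i * q j * (Num.sqrt M%:R * (cmat (a M i) e b * cmat (a M j) e' b')).

Let cmat_le M i e b : (0 < M)%N -> cmat (a M i) e b ^+ 2 <= Pw i / Num.sqrt M%:R.
Proof.
move=> M0; rewrite -aE// (cabs2_cmat _ b) (bigD1 e)//= lerDl.
by apply: sumr_ge0 => c _; exact: sqr_ge0.
Qed.

Let U_bounded i e b j e' b' :
  \forall M \near \oo, `|U i e b j e' b' M| <= q i * q j * ((Pw i + Pw j) / 2).
Proof.
near=> M.
have M0 : (0 < M)%N by near: M; exact: nbhs_infty_gt.
have s0 : 0 < Num.sqrt (M%:R : R) by rewrite sqrtr_gt0 ltr0n.
rewrite /U normrM ger0_norm ?mulr_ge0// ler_wpM2l ?mulr_ge0//.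
rewrite normrM ger0_norm; last exact: ltW.
rewrite mulrC -ler_pdivlMr//.
have := cmat_le M i e b M0; have := cmat_le M j e' b' M0.
rewrite mulrAC mulrDl.
move: (cmat _ _ _) (cmat _ _ _) (Pw j / _) (Pw i / _) => x y p1 p2 h1 h2.
rewrite ler_norml; apply/andP; split.
  by have := sqr_ge0 (x + y); nra.
by have := sqr_ge0 (x - y); nra.
Unshelve. all: by end_near. Qed.

Lemma channel_gram_cvg k l :
  Num.sqrt M%:R * (M%:R^-1 * channel_gram (channel h dist alpha w) M (a M) k l)
  @[M --> \oo] --> ((k == l)%:R * (Pw k.1 / dist k.1 `^ alpha) : R).
Proof.
case: k => i b; case: l => j b' /=.
pose delta (e e' : bool) : R := ((i, e) == (j, e'))%:R.
have gramE M : Num.sqrt M%:R * (M%:R^-1 *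
    channel_gram (channel h dist alpha w) M (a M) (i, b) (j, b')) =
    \sum_e \sum_e' D i e j e' M * U i e b j e' b' M.
  rewrite /channel_gram sum_pair/=.
  have rowE m i' c b0 : channel_row (channel h dist alpha w) M (a M) (m, c) (i', b0) =
      \sum_e cmat (cRV (h m i') w) c e * (q i' * cmat (a M i') e b0).
    rewrite /channel_row /channel/= -mulrA cmatM; apply: eq_bigr => e _; congr (_ * _).
    by rewrite mulrC cmat_scale mulrC.
  under eq_bigr => m _ do under eq_bigr => c _ do rewrite !rowE big_distrlr/=.
  under eq_bigr => m _ do rewrite exchange_big/=.
  rewrite exchange_big/= !mulr_sumr; apply: eq_bigr => e _.
  under eq_bigr => m _ do rewrite exchange_big/=.
  rewrite exchange_big/= !mulr_sumr; apply: eq_bigr => e' _.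
  rewrite /D /U mulrCA -[RHS]mulrA; congr (_ * _); rewrite mulr_sumr mulr_suml.
  apply: eq_bigr => m _; rewrite mulr_sumr mulr_suml; apply: eq_bigr => c _; ring.
have -> : ((i, b) == (j, b'))%:R * (Pw i / dist i `^ alpha) =
    \sum_(e : bool) \sum_(e' : bool) 0 + ((i, b) == (j, b'))%:R * (Pw i / dist i `^ alpha) :> R.
  by rewrite big1 ?add0r// => e _; rewrite big1.
(* The deviation of the averages from their limit tends to zero and multiplies a bounded factor; the
   constant is what the limiting averages give. *)
have : \sum_e \sum_e' (D i e j e' M - delta e e') * U i e b j e' b' M +
    ((i, b) == (j, b'))%:R * (Pw i / dist i `^ alpha) @[M --> \oo] -->
    (\sum_(e : bool) \sum_(e' : bool) 0 +
    ((i, b) == (j, b'))%:R * (Pw i / dist i `^ alpha) : R).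
  apply: cvgD; last exact: cvg_cst.
  apply: cvg_sumr => e; apply: cvg_sumr => e'.
  apply: cvg0_mul_bounded (U_bounded i e b j e' b').
  rewrite -(subrr (delta e e')); apply: cvgB; [exact: D_cvg|exact: cvg_cst].
apply: cvg_trans; apply: near_eq_cvg; near=> M.
have M0 : (0 < M)%N by near: M; exact: nbhs_infty_gt.
have s0 : Num.sqrt (M%:R : R) != 0 by rewrite gt_eqF// sqrtr_gt0 ltr0n.
rewrite gramE.
(* With the averages replaced by their limit, the value is exact for each positive [M]: [cmat_gram]
   leaves only [|a_i| ^ 2], whose [1 / sqrt M] cancels the scaling. *)
have -> : ((i, b) == (j, b'))%:R * (Pw i / dist i `^ alpha) =
    \sum_e \sum_e' delta e e' * U i e b j e' b' M.
  rewrite /delta /U; have [->|ij] := eqVneq i j; last first.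
    rewrite xpair_eqE (negbTE ij) mul0r big1// => e _; rewrite big1// => e' _.
    by rewrite xpair_eqE (negbTE ij) mul0r.
  rewrite xpair_eqE eqxx/=.
  transitivity (q j * q j * (Num.sqrt M%:R * \sum_e cmat (a M j) e b * cmat (a M j) e b')).
    by rewrite cmat_gram aE// q_sqr; field; rewrite s0 gt_eqF// powR_gt0.
  rewrite !mulr_sumr; apply: eq_bigr => e _.
  rewrite -[LHS](sum_delta e (fun e' => q j * q j *
    (Num.sqrt M%:R * (cmat (a M j) e b * cmat (a M j) e' b')))).
  by apply: eq_bigr => e' _; rewrite xpair_eqE eqxx.
rewrite -big_split/=; apply: eq_bigr => e _; rewrite -big_split/=.
by apply: eq_bigr => e' _; rewrite mulrBl subrK.
Unshelve. all: by end_near. Qed.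

End gram_limit.

Lemma cvgn_inv_sqrt {R : realType} : (Num.sqrt (n%:R : R))^-1 @[n --> \oo] --> (0 : R).
Proof.
have : Num.sqrt ((n%:R : R)^-1) @[n --> \oo] --> Num.sqrt (0 : R).
  by apply: (cvg_comp _ _ cvgn_inv_natr); exact: sqrt_continuous.
by rewrite sqrtr0; apply: cvg_trans; apply: near_eq_cvg; near=> n; rewrite sqrtrV.
Unshelve. all: by end_near. Qed.

Lemma deflection_cvg {R : realType} {N : nat} (sth2 sn2 : R) (sv2 lam : 'I_N -> R)
    (gram : nat -> 'I_N * bool -> 'I_N * bool -> R) :
  0 < sn2 ->
  (forall k l, Num.sqrt M%:R * (M%:R^-1 * gram M k l) @[M --> \oo] -->
    ((k == l)%:R * lam k.1 : R)) ->
  (M%:R^-1 * (sth2 * \sum_i \sum_j gram M (i, true) (j, true))) ^+ 2 /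
  (M%:R^-1 ^+ 2 * (2 * \sum_k \sum_l sv2 k.1 / 2 * (sv2 l.1 / 2) * gram M k l ^+ 2
    + 2 * sn2 * \sum_k sv2 k.1 / 2 * gram M k k + M%:R * sn2 ^+ 2)) @[M --> \oo] -->
  (sth2 ^+ 2 * (\sum_i lam i) ^+ 2 / (\sum_i sv2 i ^+ 2 * lam i ^+ 2 + sn2 ^+ 2) : R).
Proof.
move=> sn2_gt0 gram_cvg.
pose beta k l M : R := Num.sqrt M%:R * (M%:R^-1 * gram M k l).
pose Sb M := \sum_i \sum_j beta (i, true) (j, true) M.
pose Qb M := \sum_k \sum_l sv2 k.1 / 2 * (sv2 l.1 / 2) * beta k l M ^+ 2.
pose Lb M := \sum_k sv2 k.1 / 2 * beta k k M.
have S_cvg : Sb M @[M --> \oo] --> \sum_i lam i.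
  have -> : \sum_i lam i = \sum_i \sum_j ((i, true) == (j, true))%:R * lam i.
    apply: eq_bigr => i _; rewrite -[LHS](sum_delta i (fun=> lam i)).
    by apply: eq_bigr => j _; rewrite xpair_eqE andbT.
  by apply: cvg_sumr => i; apply: cvg_sumr => j; exact: gram_cvg.
(* Only diagonal terms survive; each sensor has two real components with weight [(sv2 / 2) ^ 2], and
   the outer 2 restores [sv2 ^ 2]. *)
have Q_cvg : 2 * Qb M @[M --> \oo] --> \sum_i sv2 i ^+ 2 * lam i ^+ 2.
  have -> : \sum_i sv2 i ^+ 2 * lam i ^+ 2 = 2 * \sum_(k : 'I_N * bool) \sum_l
      sv2 k.1 / 2 * (sv2 l.1 / 2) * ((k == l)%:R * lam k.1) ^+ 2.
    rewrite sum_pair mulr_sumr; apply: eq_bigr => i _; rewrite sum_bool.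
    have E b : \sum_l sv2 (i, b).1 / 2 * (sv2 l.1 / 2) * (((i, b) == l)%:R * lam (i, b).1) ^+ 2
        = (sv2 i / 2) ^+ 2 * lam i ^+ 2.
      rewrite -[RHS](sum_delta (i, b) (fun l => sv2 i / 2 * (sv2 l.1 / 2) * lam i ^+ 2)).
      by apply: eq_bigr => l _; case: (_ == l) => /=; ring.
    by rewrite !E; field.
  apply: cvgM; first exact: cvg_cst.
  apply: cvg_sumr => k; apply: cvg_sumr => l; apply: cvgM; first exact: cvg_cst.
  by apply: cvgM; exact: gram_cvg.
have L_cvg : 2 * sn2 * Lb M * (Num.sqrt M%:R)^-1 @[M --> \oo] --> (0 : R).
  rewrite -[X in _ --> X](mulr0 (2 * sn2 * \sum_(k : 'I_N * bool) sv2 k.1 / 2 * ((k == k)%:R * lam k.1))).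
  apply: cvgM; last exact: cvgn_inv_sqrt.
  apply: cvgM; first exact: cvg_cst.
  by apply: cvg_sumr => k; apply: cvgM; [exact: cvg_cst|exact: gram_cvg].
have D_cvg : 2 * Qb M + 2 * sn2 * Lb M * (Num.sqrt M%:R)^-1 + sn2 ^+ 2 @[M --> \oo] -->
    \sum_i sv2 i ^+ 2 * lam i ^+ 2 + sn2 ^+ 2.
  rewrite -[X in _ --> X + _]addr0.
  by apply: cvgD; [apply: cvgD; [exact: Q_cvg|exact: L_cvg]|exact: cvg_cst].
have D_neq0 : \sum_i sv2 i ^+ 2 * lam i ^+ 2 + sn2 ^+ 2 != 0.
  rewrite gt_eqF// ltr_wpDl ?exprn_gt0// sumr_ge0// => i _.
  by rewrite mulr_ge0// sqr_ge0.
have : sth2 ^+ 2 * Sb M ^+ 2 / (2 * Qb M + 2 * sn2 * Lb M * (Num.sqrt M%:R)^-1 + sn2 ^+ 2)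
    @[M --> \oo] --> 
    (sth2 ^+ 2 * (\sum_i lam i) ^+ 2 / (\sum_i sv2 i ^+ 2 * lam i ^+ 2 + sn2 ^+ 2) : R).
  apply: cvgM; last by apply: cvgV.
  by apply: cvgM; [exact: cvg_cst|apply: cvgM; exact: S_cvg].
apply: cvg_trans; apply: near_eq_cvg; near=> M.
have M0 : (0 < M)%N by near: M; exact: nbhs_infty_gt.
have gramE k l : gram M k l = Num.sqrt M%:R * beta k l M.
  by rewrite /beta mulrA -expr2 sqr_sqrtr// mulrA divff ?mul1r// pnatr_eq0 -lt0n.
have -> : \sum_i \sum_j gram M (i, true) (j, true) = Num.sqrt M%:R * Sb M.
  rewrite mulr_sumr; apply: eq_bigr => i _; rewrite mulr_sumr.
  by apply: eq_bigr => j _; rewrite gramE.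
have -> : \sum_k \sum_l sv2 k.1 / 2 * (sv2 l.1 / 2) * gram M k l ^+ 2 =
    Num.sqrt M%:R ^+ 2 * Qb M.
  rewrite mulr_sumr; apply: eq_bigr => k _; rewrite mulr_sumr.
  by apply: eq_bigr => l _; rewrite gramE; ring.
have -> : \sum_k sv2 k.1 / 2 * gram M k k = Num.sqrt M%:R * Lb M.
  by rewrite mulr_sumr; apply: eq_bigr => k _; rewrite gramE; ring.
have x0 : Num.sqrt (M%:R : R) != 0 by rewrite gt_eqF// sqrtr_gt0 ltr0n.
have -> : (M%:R : R) = Num.sqrt M%:R ^+ 2 by rewrite sqr_sqrtr.
rewrite sqrtr_sqr ger0_norm//.
move: (Num.sqrt _) x0 => x x0.
(* With [x = sqrt M], numerator and denominator both carry the factor [x ^ -2], which cancels. *)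
set den := 2 * Qb M + _ + _.
have -> : 2 * (x ^+ 2 * Qb M) + 2 * sn2 * (x * Lb M) + x ^+ 2 * sn2 ^+ 2 = x ^+ 2 * den.
  by rewrite /den; field.
rewrite !invfM !invrK.
move: (den^-1) => y.
by field.
Unshelve. all: by end_near. Qed.

Theorem theorem3 (R : realType) (N : nat)
  (sth2 sn2 alpha : R) (sv2 dist Pw : 'I_N -> R)
  (Hsth : 0 < sth2) (Hsn : 0 < sn2) (Halpha : 0 < alpha)
  (Hsv : forall i, 0 < sv2 i) (Hdist : forall i, 0 < dist i)
  (HPw : forall i, 0 <= Pw i)
  (a : nat -> 'I_N -> R[i])
  (Ha : forall M, (0 < M)%N -> forall i, cabs2 (a M i) = Pw i / Num.sqrt M%:R)
  (* channel probability space: htilde_{mi} i.i.d. CN(0,1) *)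
  (dP : measure_display) (Om : measurableType dP) (PP : probability Om R)
  (h : nat -> 'I_N -> bool -> {RV PP >-> R})
  (Hh_ind : mutually_independent (fun k : nat * 'I_N * bool => h k.1.1 k.1.2 k.2))
  (Hh_law : forall m i b, has_normal_law (h m i b) (1 / 2))
  (* signal/noise probability space: theta, v, n independent complex Gaussians *)
  (dQ : measure_display) (Xi : measurableType dQ) (Q : probability Xi R)
  (th : bool -> {RV Q >-> R}) (v : 'I_N -> bool -> {RV Q >-> R})
  (n : nat -> bool -> {RV Q >-> R})
  (Hind : mutually_independent (noise_family th v n))
  (Hth_law : forall b, has_normal_law (th b) (sth2 / 2))
  (Hv_law : forall i b, has_normal_law (v i b) (sv2 i / 2))
  (Hn_law : forall m b, has_normal_law (n m b) (sn2 / 2)) :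
  {ae PP, forall w,
    (fun M : nat => deflection th v n (channel h dist alpha w) M (a M)) @ \oo -->
      sth2 ^+ 2 * (\sum_(i < N) Pw i / dist i `^ alpha) ^+ 2
      / (\sum_(i < N) sv2 i ^+ 2 * Pw i ^+ 2 / (dist i `^ alpha) ^+ 2 + sn2 ^+ 2)}.
Proof.
(* Randomness of the channel enters only here; for each remaining [w] the argument is
   deterministic. *)
have := ae_channel_averages PP h Hh_ind Hh_law.
apply: filterS => w hw.
have H := deflection_cvg sth2 sn2 sv2 (fun i => Pw i / dist i `^ alpha)
  (fun M => channel_gram (channel h dist alpha w) M (a M)) Hsn
  (channel_gram_cvg alpha dist Pw Hdist a Ha PP h w hw).
have -> : \sum_(i < N) sv2 i ^+ 2 * Pw i ^+ 2 / (dist i `^ alpha) ^+ 2 =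
    \sum_(i < N) sv2 i ^+ 2 * (Pw i / dist i `^ alpha) ^+ 2.
  by apply: eq_bigr => i _; rewrite expr_div_n [RHS]mulrA.
apply: cvg_trans H; apply: near_eq_cvg; apply: nearW => M.
by rewrite (deflectionE sth2 sn2 sv2).
Qed.
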